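(* Let $\Gamma$ and $\Lambda$ be simplicial graphs with finite clique number, and let $\varphi:A_\Gamma\to A_\Lambda$ be a quasiisometric embedding. If $\varphi$ is weakly stable and the $\varphi$-image of every standard $2$-flat in $X_\Gamma$ is at finite Hausdorff distance from a $2$-flat in $X_\Lambda$, then $\varphi$ induces a combinatorial embedding $f:\Gamma^{\mathrm{ext}}\to\Lambda^{\mathrm{ext}}$. In particular, this occurs when $\varphi$ is stable.
   Context: For a simplicial graph $\Gamma$, the right-angled Artin group $A_\Gamma$ has one generator $s_v$ for each vertex $v$ of $\Gamma$ (the standard generators), with relations $s_vs_w=s_ws_v$ whenever $v,w$ are adjacent; it carries the corresponding word metric. $X_\Gamma$ is the CAT(0) cube complex whose 1-skeleton is the Cayley graph of $A_\Gamma$ with respect to the standard generators (the universal cover of the Salvetti complex). If $\Gamma$ has finite clique number, then $X_\Gamma$ is quasiisometric to $A_\Gamma$, and $\varphi$ may be regarded as a map $X_\Gamma\to X_\Lambda$. A $2$-flat is an isometrically embedded Euclidean plane with respect to the CAT(0) metric (each cube being a Euclidean unit cube). A standard geodesic is a geodesic in the 1-skeleton of $X_\Gamma$ with vertex set a coset $g\langle s_v\rangle$. A standard $2$-flat is a flat with vertex set a coset $g\langle s_v,s_w\rangle$ with $v,w$ adjacent in $\Gamma$. Two standard geodesics are parallel if they are at finite Hausdorff distance. A quasiisometric embedding $\varphi:A_\Gamma\to A_\Lambda$ is stable if there is a constant $D$ such that $\varphi$ sends every standard geodesic of $A_\Gamma$ within Hausdorff distance at most $D$ of some standard geodesic of $A_\Lambda$;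 it is weakly stable if $\varphi$ sends every standard geodesic of $A_\Gamma$ within finite Hausdorff distance of a standard geodesic of $A_\Lambda$. The extension graph $\Gamma^{\mathrm{ext}}$ has a vertex for each parallelism class of standard geodesics in $X_\Gamma$, with two classes joined by an edge if they admit representatives that span a $2$-flat of $X_\Gamma$. (Equivalently, its vertices are the conjugates $gs_vg^{-1}$, and $gs_vg^{-1}$ is joined to $gs_wg^{-1}$ for $g\in A_\Gamma$ and $v,w$ adjacent in $\Gamma$.) A combinatorial embedding is a map that is injective on vertices and sends adjacent vertices to adjacent vertices. $\varphi$ induces $f$ if, for every standard geodesic $\gamma$ of $A_\Gamma$, $\varphi(\gamma)$ is at finite Hausdorff distance from a standard geodesic representing $f([\gamma])$. *)

(* Defs.v *)
From HB Require Import structures.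
From mathcomp Require Import all_boot all_order all_algebra finmap generic_quotient.
From mathcomp Require Import boolp classical_sets reals.

Set Implicit Arguments.
Unset Strict Implicit.
Unset Printing Implicit Defensive.

Import Order.TTheory GRing.Theory Num.Theory.
Local Open Scope classical_set_scope.
Local Open Scope group_scope.
Local Open Scope quotient_scope.

Record sgraph := SGraph {
  vert :> choiceType;
  adj : rel vert;
  adj_sym : symmetric adj;
  adj_irr : irreflexive adj }.

Definition clique (G : sgraph) (s : {fset G}) : Prop :=
  forall u v, u \in s -> v \in s -> u != v -> adj u v.

Definition finite_clique_number (G : sgraph) : Prop :=
  exists N : nat, forall s : {fset G}, clique s -> (#|` s| <= N)%N.

Definition combinatorial_embedding (G L : sgraph) (f : G -> L) : Prop :=
  injective f /\ forall u v, adj u v -> adj (f u) (f v).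

Section RAAG.
Variable G : sgraph.

(* (v, true) is the letter s_v and (v, false) is the letter s_v^-1 *)
Definition word := seq (G * bool).

Inductive raag_eq : word -> word -> Prop :=
| raag_refl w : raag_eq w w
| raag_sym w1 w2 : raag_eq w1 w2 -> raag_eq w2 w1
| raag_trans w1 w2 w3 : raag_eq w1 w2 -> raag_eq w2 w3 -> raag_eq w1 w3
| raag_cat w1 w1' w2 w2' :
    raag_eq w1 w1' -> raag_eq w2 w2' -> raag_eq (w1 ++ w2) (w1' ++ w2')
| raag_cancel v b : raag_eq [:: (v, b); (v, ~~ b)] [::]
| raag_comm v w : adj v w ->
    raag_eq [:: (v, true); (w, true)] [:: (w, true); (v, true)].

Definition raag_eqb (w1 w2 : word) : bool := `[< raag_eq w1 w2 >].

Lemma raag_eqb_equiv : equiv_class_of raag_eqb.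
Proof.
split=> [w|w1 w2|w2 w1 w3].
- exact/asboolP/raag_refl.
- by apply/asboolP/asboolP => /raag_sym.
- by move=> /asboolP h1 /asboolP h2; apply/asboolP/(raag_trans h1).
Qed.

Canonical raag_equiv := EquivRelPack raag_eqb_equiv.

Definition raag := {eq_quot raag_equiv}.

HB.instance Definition _ := Choice.on raag.

Definition of_word (w : word) : raag := \pi_raag w.

Lemma of_wordP w1 w2 : of_word w1 = of_word w2 <-> raag_eq w1 w2.
Proof.
split=> [/eqP|h]; first by rewrite eqmodE => /asboolP.
by apply/eqP; rewrite eqmodE; apply/asboolP.
Qed.

Lemma of_word_repr (g : raag) : of_word (repr g) = g.
Proof. exact: reprK. Qed.

Lemma raag_eq_repr w : raag_eq (repr (of_word w)) w.
Proof. by apply/of_wordP; rewrite of_word_repr. Qed.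

Definition winv (w : word) : word := rev [seq (p.1, ~~ p.2) | p <- w].

Lemma winv_cat w1 w2 : winv (w1 ++ w2) = winv w2 ++ winv w1.
Proof. by rewrite /winv map_cat rev_cat. Qed.

Lemma winvK : involutive winv.
Proof.
move=> w; rewrite /winv map_rev revK -map_comp -[RHS]map_id.
by apply: eq_map => -[v b] /=; rewrite negbK.
Qed.

Lemma winvr w : raag_eq (w ++ winv w) [::].
Proof.
elim: w => [|[v b] w IHw]; first exact: raag_refl.
rewrite -cat1s winv_cat -!catA; apply: raag_trans (raag_cancel v b).
rewrite -[X in raag_eq _ X]/([:: (v, b)] ++ ([::] ++ winv [:: (v, b)])).
apply: raag_cat; first exact: raag_refl.
by rewrite catA; apply: raag_cat => //; exact: raag_refl.
Qed.

Lemma winvl w : raag_eq (winv w ++ w) [::].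
Proof. by have := winvr (winv w); rewrite winvK. Qed.

Lemma raag_eq_winv w1 w2 : raag_eq w1 w2 -> raag_eq (winv w1) (winv w2).
Proof.
move=> h.
have h1 : raag_eq (winv w1) ((winv w1 ++ w2) ++ winv w2).
  rewrite -catA -[X in raag_eq X _]cats0.
  by apply: raag_cat; [exact: raag_refl | exact/raag_sym/winvr].
apply: raag_trans h1 _; rewrite -[X in raag_eq _ X]cat0s.
apply: raag_cat (raag_refl _); apply: raag_trans (winvl w1).
by apply: raag_cat (raag_refl _) _; exact: raag_sym.
Qed.

Definition raag_mul (g h : raag) : raag := of_word (repr g ++ repr h).
Definition raag_inv (g : raag) : raag := of_word (winv (repr g)).

Lemma of_word_cat w1 w2 : of_word (w1 ++ w2) = raag_mul (of_word w1) (of_word w2).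
Proof. by apply/of_wordP/raag_sym/raag_cat; exact: raag_eq_repr. Qed.

Lemma of_word_winv w : of_word (winv w) = raag_inv (of_word w).
Proof. by apply/of_wordP/raag_sym/raag_eq_winv; exact: raag_eq_repr. Qed.

Lemma raag_mulA : associative raag_mul.
Proof.
move=> x y z; rewrite -[x]of_word_repr -[y]of_word_repr -[z]of_word_repr.
by rewrite -!of_word_cat catA.
Qed.

Lemma raag_mul1 : left_id (of_word [::]) raag_mul.
Proof. by move=> x; rewrite -[x]of_word_repr -of_word_cat. Qed.

Lemma raag_mulr1 : right_id (of_word [::]) raag_mul.
Proof. by move=> x; rewrite -[x]of_word_repr -of_word_cat cats0. Qed.

Lemma raag_mulV : left_inverse (of_word [::]) raag_inv raag_mul.
Proof.
move=> x; rewrite -[x]of_word_repr -of_word_winv -of_word_cat.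
exact/of_wordP/winvl.
Qed.

Lemma raag_mulrV : right_inverse (of_word [::]) raag_inv raag_mul.
Proof.
move=> x; rewrite -[x]of_word_repr -of_word_winv -of_word_cat.
exact/of_wordP/winvr.
Qed.

HB.instance Definition _ := isGroup.Build raag
  raag_mulA raag_mul1 raag_mulr1 raag_mulV raag_mulrV.

Definition gen (v : G) : raag := of_word [:: (v, true)].

Lemma genC v w : adj v w -> gen v * gen w = gen w * gen v.
Proof.
by move=> vw; rewrite -[LHS]of_word_cat -[RHS]of_word_cat; exact/of_wordP/raag_comm.
Qed.

Lemma of_word_size_ex (g : raag) :
  exists n, `[< exists w : word, size w = n /\ of_word w = g >].
Proof.
by exists (size (repr g)); apply/asboolP; exists (repr g); rewrite of_word_repr.
Qed.

Definition word_length (g : raag) : nat := ex_minn (of_word_size_ex g).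

(* the Cayley graph has an edge from g to g * gen v *)
Definition word_dist (g h : raag) : nat := word_length (g^-1 * h).

Definition is_subgroup (H : set raag) : Prop :=
  H 1 /\ forall x y, H x -> H y -> H (x * y^-1).

(* the left coset g <S> of the subgroup generated by S *)
Definition gen_coset (g : raag) (S : set raag) : set raag :=
  [set g * h | h in smallest is_subgroup S].

End RAAG.

Section CubeComplex.
Variables (R : realType) (G : sgraph).
Local Open Scope ring_scope.

(* The cubes of X_G have vertex sets g * {\prod_(v in t) gen v | t `<=` s}, with g in
   the group and s a clique. Each point lies in the interior of exactly one cube:
   [base] is the corner g of that cube, [coord] are the coordinates of the point
   in it, and s is the support of [coord]. *)
Record cpoint := CPoint {
  base : raag G;
  coord : {fsfun G -> R with 0};
  coord_clique : clique (finsupp coord);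
  coord_itv : forall v, 0 <= coord v < 1 }.

Lemma clique_fsfun0 : clique (finsupp ([fsfun] : {fsfun G -> R with 0})).
Proof. by move=> u v; rewrite finsupp0 in_fset0. Qed.

Lemma fsfun0_itv (v : G) : 0 <= ([fsfun] : {fsfun G -> R with 0}) v < 1.
Proof. by rewrite fsfun0E lexx ltr01. Qed.

Definition vertex (g : raag G) : cpoint :=
  CPoint g clique_fsfun0 fsfun0_itv.

(* [x] is the point with coordinates [a] in the closed cube with corner [g]
   spanned by the clique [s]. The generators in the product commute, so the order
   of enumeration of [s] is irrelevant; so are the values of [a] outside [s]. *)
Definition cube_point (g : raag G) (s : {fset G}) (a : G -> R) (x : cpoint) : Prop :=
  [/\ clique s,
      forall v, v \in s -> 0 <= a v <= 1,
      base x = (g * \prod_(v <- s | a v == 1%R) gen v)%g &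
      forall v, coord x v = if (v \in s) && (a v < 1) then a v else 0].

Definition cube_dist (s : {fset G}) (a b : G -> R) : R :=
  Num.sqrt (\sum_(v <- s) (a v - b v) ^+ 2).

(* [chain x y l]: there is a string of points from x to y, any two consecutive
   ones lying in a common cube, with sum of Euclidean distances l *)
Inductive chain : cpoint -> cpoint -> R -> Prop :=
| chain_nil x : chain x x 0
| chain_cons x y z l g s a b :
    cube_point g s a x -> cube_point g s b y -> chain y z l ->
    chain x z (cube_dist s a b + l).

Definition cat0_dist (x y : cpoint) : R := inf [set l | chain x y l].

Definition eucl_dist (p q : R * R) : R :=
  Num.sqrt ((p.1 - q.1) ^+ 2 + (p.2 - q.2) ^+ 2).

Definition is_flat (F : set cpoint) : Prop :=
  exists e : R * R -> cpoint,
    (forall p q, cat0_dist (e p) (e q) = eucl_dist p q) /\ F = range e.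

Definition vertex_set (A : set cpoint) : set (raag G) := [set g | A (vertex g)].

(* empty if g and h are not adjacent in the Cayley graph *)
Definition edge (g h : raag G) : set cpoint :=
  [set x | exists v a,
     (h = g * gen v)%g /\ cube_point g [fset v]%fset a x \/
     (g = h * gen v)%g /\ cube_point h [fset v]%fset a x].

Definition is_geodesic1 (l : set cpoint) : Prop :=
  exists c : int -> raag G,
    (forall m n : int, word_dist (c m) (c n) = `|m - n|%N) /\
    l = \bigcup_(n in setT) edge (c n) (c (n + 1)).

Definition standard_geodesic (l : set cpoint) : Prop :=
  is_geodesic1 l /\
  exists g v, vertex_set l = gen_coset g [set gen v].

Definition standard_flat (F : set cpoint) : Prop :=
  is_flat F /\
  exists g v w, adj v w /\ vertex_set F = gen_coset g [set gen v; gen w].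

End CubeComplex.

Arguments cat0_dist {R G}.
Arguments vertex_set {R G}.

Section Hausdorff.
Variables (R : realType) (T : Type) (d : T -> T -> R).
Local Open Scope ring_scope.

Definition hausdorff_le (D : R) (A B : set T) : Prop :=
  (forall x, A x -> exists2 y, B y & d x y <= D) /\
  (forall y, B y -> exists2 x, A x & d x y <= D).

Definition finite_hausdorff (A B : set T) : Prop := exists D, hausdorff_le D A B.

End Hausdorff.

Section ExtensionGraph.
Variables (R : realType) (G : sgraph).
Local Open Scope ring_scope.
Local Notation X := (cpoint R G).

Definition parallel (l l' : set X) : Prop := finite_hausdorff cat0_dist l l'.

(* geodesics of X realise distances, so z lies on a geodesic from x to y iff
   the triangle inequality is an equality *)
Definition cat0_convex (C : set X) : Prop :=
  forall x y z, C x -> C y ->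
    cat0_dist x z + cat0_dist z y = cat0_dist x y -> C z.

Definition span_flat (l l' : set X) : Prop :=
  is_flat (smallest cat0_convex (l `|` l')).

Definition is_parallel_class (c : set (set X)) : Prop :=
  exists2 l, standard_geodesic l &
    c = [set l' | standard_geodesic l' /\ parallel l l'].

Definition parallel_class := {c : set (set X) | `[< is_parallel_class c >]}.

Definition represents (l : set X) (c : parallel_class) : Prop := (\val c) l.

Definition ext_adj (c c' : parallel_class) : bool :=
  (c != c') &&
  `[< exists l l', [/\ represents l c, represents l' c' & span_flat l l'] >].

Lemma ext_adj_sym : symmetric ext_adj.
Proof.
move=> c c'; rewrite /ext_adj eq_sym; congr (_ && _).
by apply/asboolP/asboolP => -[l [l' [? ? h]]]; exists l', l;
  split=> //; rewrite /span_flat setUC.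
Qed.

Lemma ext_adj_irr : irreflexive ext_adj.
Proof. by move=> c; rewrite /ext_adj eqxx. Qed.

Definition ext_graph : sgraph := SGraph ext_adj_sym ext_adj_irr.

End ExtensionGraph.

Section Maps.
Variables (R : realType) (G L : sgraph) (phi : raag G -> raag L).
Local Open Scope ring_scope.

Definition wdist (H : sgraph) (g h : raag H) : R := (word_dist g h)%:R.

Definition qi_embedding : Prop :=
  exists K C : R, [/\ 1 <= K, 0 <= C &
    forall g h, K^-1 * wdist g h - C <= wdist (phi g) (phi h) <= K * wdist g h + C].

(* A standard geodesic of the group is the vertex set of one of the complex. *)

Definition stable : Prop :=
  exists D : R, forall l : set (cpoint R G), standard_geodesic l ->
    exists2 l' : set (cpoint R L), standard_geodesic l' &
      hausdorff_le (@wdist L) D (phi @` vertex_set l) (vertex_set l').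

Definition weakly_stable : Prop :=
  forall l : set (cpoint R G), standard_geodesic l ->
    exists2 l' : set (cpoint R L), standard_geodesic l' &
      finite_hausdorff (@wdist L) (phi @` vertex_set l) (vertex_set l').

(* phi regarded as a map of complexes: x is at bounded distance from its corner
   [base x] when the clique number is finite *)
Definition complex_map (x : cpoint R G) : cpoint R L := vertex R (phi (base x)).

Definition induces (f : ext_graph R G -> ext_graph R L) : Prop :=
  forall (c : ext_graph R G) l, represents l c ->
    exists2 l', represents l' (f c) &
      finite_hausdorff (@wdist L) (phi @` vertex_set l) (vertex_set l').

End Maps.

(* Main.v *)
From HB Require Import structures.
From mathcomp Require Import all_boot all_order all_algebra finmap.
From mathcomp Require Import boolp classical_sets reals.
From mathcomp Require Import zify ring lra.
Require Import Defs.

(** The proof compares distances by means of one kind of function. Fix a vertex [a] of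
the graph and a set [P] of group elements that is stable under right multiplication by
the generators in the star of [a]. Counting with sign the [a]-edges that a path crosses
at vertices in [P] gives a number that depends only on the end points: both sides of a
square that has [a]-edges count equally because [P] is stable. This is the height of
[a] and [P]. It extends affinely to cubes, where up to a constant it is zero or one of
the coordinates, so it is 1-Lipschitz for the CAT(0) distance, and several heights with
distinct labels form a 1-Lipschitz map to a Euclidean space ([ht_euclid]). These maps
give all the lower bounds for the CAT(0) distance that are needed below.

If [P] is the coset of [h] of the subgroup generated by the star of [a], the height grows
at unit speed along the geodesic [h <a>] and is constant on every standard geodesic that
is not parallel to it. So two standard geodesics are at finite Hausdorff distance, in
the complex or in the group, exactly when they have the same label and base points in one
such coset ([parallelP]). Parallelism is therefore visible in the word metric; weak
stability yields a map [f] of parallelism classes, which is injective because a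
quasiisometric embedding reflects finite Hausdorff distance.

For adjacency, first take adjacent classes in the source. Their representatives are
nonparallel affine lines in a common flat, so they cross, at a vertex [k], and their
labels [v], [w] are adjacent since otherwise both the sum and the difference of the
exponents of [v] and [w] would be 1-Lipschitz ([ext_adj_standard]). Conversely, two
geodesics through [k] with adjacent labels span the standard flat with vertices
[k <v, w>]: the two exponents and a subdivision of segments show that it is a flat, and a
third height, that of a hyperplane next to the flat, shows that it is convex
([plane_span]).

It remains to find for the image geodesics, of directions [a] and [b], parallels through
a common vertex with [a], [b] adjacent. Suppose that there are none. Then no cube has
edges counted by the heights [t1] and [t2] of both geodesics, so [t1 + t2] and [t1 - t2]
are 1-Lipschitz. A flat near the image of the standard flat contains quasilines along
which [t1], respectively [t2], grows at unit speed, and this contradicts the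
parallelogram law ([flat_crossing]). When the embedding is stable, every point of the
first image geodesic is instead at bounded distance from a parallel of the second one;
there [t1] is constant ([height_crossing]), so [t1] would be bounded on a geodesic along
which it grows. *)

Set Implicit Arguments.
Unset Strict Implicit.
Unset Printing Implicit Defensive.

Import Order.TTheory GRing.Theory Num.Theory.
Local Open Scope classical_set_scope.
Local Open Scope ring_scope.

(** * Words, powers and stars *)

Section Words.
Variable G : sgraph.
Implicit Types (g h k : raag G) (p : G * bool) (w : word G).

Definition letter p : raag G := of_word [:: p].

Lemma of_word_nil : of_word [::] = 1%g :> raag G.
Proof. by []. Qed.

Lemma of_word_mul w1 w2 : of_word (w1 ++ w2) = (of_word w1 * of_word w2)%g.
Proof. exact: of_word_cat. Qed.

Lemma of_word_cons p w : of_word (p :: w) = (letter p * of_word w)%g.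
Proof. exact: (of_word_mul [:: p]). Qed.

Lemma letter_false v : letter (v, false) = (gen v)^-1%g.
Proof. exact: (of_word_winv [:: (v, true)]). Qed.

Lemma letter_neg v b : letter (v, ~~ b) = (letter (v, b))^-1%g.
Proof. by case: b; rewrite letter_false ?invgK. Qed.

Lemma of_word_inv w : of_word (winv w) = (of_word w)^-1%g.
Proof. exact: of_word_winv. Qed.

Lemma of_word_surj g : exists w, of_word w = g.
Proof. by exists (repr g); rewrite of_word_repr. Qed.

Lemma word_lengthP g : exists2 w, of_word w = g & size w = word_length g.
Proof.
rewrite /word_length; case: ex_minnP => n /asboolP[w [<- <-]] _.
by exists w.
Qed.

Lemma word_length_le w : (word_length (of_word w) <= size w)%N.
Proof.
rewrite /word_length; case: ex_minnP => n _; apply.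
by apply/asboolP; exists w.
Qed.

Lemma word_length_mul g h :
  (word_length (g * h)%g <= word_length g + word_length h)%N.
Proof.
have [w1 <- <-] := word_lengthP g; have [w2 <- <-] := word_lengthP h.
by rewrite -of_word_mul -size_cat word_length_le.
Qed.

Lemma word_length_inv g : word_length g^-1%g = word_length g.
Proof.
suff le h : (word_length h^-1%g <= word_length h)%N.
  by apply/eqP; rewrite eqn_leq le -{1}[g]invgK le.
have [w <- <-] := word_lengthP h; rewrite -of_word_inv.
by apply: leq_trans (word_length_le _) _; rewrite /winv size_rev size_map.
Qed.

Lemma word_dist_sym g h : word_dist g h = word_dist h g.
Proof. by rewrite /word_dist -word_length_inv invgM invgK. Qed.

Lemma word_dist_tri g h k : (word_dist g k <= word_dist g h + word_dist h k)%N.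
Proof.
rewrite /word_dist; apply: leq_trans (word_length_mul _ _).
by rewrite mulgA mulgK.
Qed.

Definition zpow g (n : int) : raag G :=
  match n with Posz m => (g ^+ m)%g | Negz m => (g ^- m.+1)%g end.

Lemma zpow0 g : zpow g 0 = 1%g. Proof. exact: expg0. Qed.

Lemma zpow1 g : zpow g 1 = g. Proof. exact: expg1. Qed.

Lemma zpowS g n : zpow g (n + 1) = (zpow g n * g)%g.
Proof.
case: n => [m|[|m]].
- by rewrite -PoszD addn1 /= expgSr.
- by rewrite (_ : Negz 0 + 1 = 0) //= expg0 expg1 mulVg.
rewrite (_ : Negz m.+1 + 1 = Negz m); last by lia.
by rewrite /= [in RHS]expgS invgM mulgVK.
Qed.

Lemma zpowB1 g n : zpow g (n - 1) = (zpow g n * g^-1)%g.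
Proof. by rewrite -{2}[n](subrK 1) zpowS mulgK. Qed.

Lemma zpowD g m n : zpow g (m + n) = (zpow g m * zpow g n)%g.
Proof.
elim: n => [|n IH|n IH].
- by rewrite addr0 zpow0 mulg1.
- by rewrite -addn1 PoszD addrA !zpowS IH mulgA.
by rewrite -addn1 PoszD opprD addrA !zpowB1 IH mulgA.
Qed.

Lemma zpowN g n : zpow g (- n) = (zpow g n)^-1%g.
Proof. by apply/esym/mulg1_eq; rewrite -zpowD subrr zpow0. Qed.

Lemma zpow_ind (P : raag G -> Prop) g h : P h ->
  (forall y, P y -> P (y * g)%g) -> (forall y, P y -> P (y * g^-1)%g) ->
  forall n, P (h * zpow g n)%g.
Proof.
move=> P0 PM PV; elim=> [|n IH|n IH]; first by rewrite zpow0 mulg1.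
  by rewrite -addn1 PoszD zpowS mulgA; exact: PM.
by rewrite -addn1 PoszD opprD zpowB1 mulgA; exact: PV.
Qed.

Lemma zpow_commute g h n : commute g h -> commute g (zpow h n).
Proof.
move=> gh; case: n => [m|m] /=; first exact: commuteX.
by apply: commuteV; exact: commuteX.
Qed.

Lemma zpow_commute2 g h m n : commute g h -> commute (zpow g m) (zpow h n).
Proof.
by move=> gh; apply/zpow_commute/commute_sym/zpow_commute/commute_sym.
Qed.

(** The closed star of a vertex: the generators of its centraliser. *)
Definition star (a c : G) := (c == a) || adj a c.

Lemma star_refl a : star a a. Proof. by rewrite /star eqxx. Qed.

Lemma star_sym a c : star a c = star c a.
Proof. by rewrite /star eq_sym adj_sym. Qed.

Lemma star_commute a c : star a c -> commute (gen a) (gen c).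
Proof. by case/orP => [/eqP->|/genC]; [exact: commute_refl|]. Qed.

(** The coset of the subgroup generated by the star of [a]: the vertex set of the union
of all standard geodesics parallel to [h <a>]. *)
Definition star_coset (a : G) h k : Prop :=
  exists2 w, all (fun p => star a p.1) w & k = (h * of_word w)%g.

Lemma star_coset_refl a h : star_coset a h h.
Proof. by exists [::]; rewrite // mulg1. Qed.

Lemma star_coset_trans a h k l :
  star_coset a h k -> star_coset a k l -> star_coset a h l.
Proof.
move=> [w1 s1 ->] [w2 s2 ->]; exists (w1 ++ w2); first by rewrite all_cat s1.
by rewrite of_word_mul mulgA.
Qed.

Lemma star_coset_sym a h k : star_coset a h k -> star_coset a k h.
Proof.
move=> [w s1 ->]; exists (winv w); last by rewrite of_word_inv mulgK.
by rewrite /winv all_rev all_map; apply: sub_all s1.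
Qed.

Lemma star_coset_letter a h p : star a p.1 -> star_coset a h (h * letter p)%g.
Proof. by move=> ap; exists [:: p]; rewrite //= ap. Qed.

Lemma star_coset_gen a h c : star a c -> star_coset a h (h * gen c)%g.
Proof. exact: (@star_coset_letter a h (c, true)). Qed.

Lemma star_coset_zpow a h c n :
  star a c -> star_coset a h (h * zpow (gen c) n)%g.
Proof.
move=> ac; apply: zpow_ind => [|y hy|y hy]; first exact: star_coset_refl.
  exact: star_coset_trans hy (star_coset_gen _ ac).
by rewrite -letter_false; apply: star_coset_trans hy (star_coset_letter _ _).
Qed.

Lemma star_word_commute a w :
  all (fun p => star a p.1) w -> commute (gen a) (of_word w).
Proof.
elim: w => [_|[c b] w IH /= /andP[ac aw]].
  by rewrite of_word_nil; exact: commute1.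
rewrite of_word_cons; apply: commuteM (IH aw).
case: b; first exact: star_commute.
by rewrite letter_false; apply/commuteV/star_commute.
Qed.

End Words.

(** * Heights *)

Section Height.
Variables (G : sgraph) (a : G) (P : raag G -> Prop).
Implicit Types (g h k y : raag G) (p : G * bool) (w : word G).

Definition star_invariant : Prop :=
  forall y c, star a c -> P (y * gen c)%g <-> P y.

Hypothesis P_inv : star_invariant.

Lemma star_invariant_letter y p : star a p.1 -> P (y * letter p)%g <-> P y.
Proof.
case: p => c [] /= ac; first exact: P_inv.
by rewrite letter_false -(P_inv _ ac) mulgVK.
Qed.

Definition step y p : int :=
  if (p.1 == a) && `[< P y >] then (if p.2 then 1 else -1) else 0.

Fixpoint rise y w : int :=
  if w is p :: w' then step y p + rise (y * letter p)%g w' else 0.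

Lemma rise_cat y w1 w2 :
  rise y (w1 ++ w2) = rise y w1 + rise (y * of_word w1)%g w2.
Proof.
elim: w1 y => [|p w IH] y /=; first by rewrite add0r of_word_nil mulg1.
by rewrite IH of_word_cons mulgA addrA.
Qed.

(** A commuting pair of letters contributes the same in both orders because [P]
is constant along the edges that span a square with an [a]-edge. *)
Lemma rise_raag_eq w1 w2 : raag_eq w1 w2 -> forall y, rise y w1 = rise y w2.
Proof.
elim=> // {w1 w2}.
- by move=> w1 w2 w3 _ IH1 _ IH2 y; rewrite IH1.
- move=> w1 w1' w2 w2' /of_wordP E IH1 _ IH2 y.
  by rewrite !rise_cat IH1 IH2 E.
- move=> v b y /=; rewrite /step /= addr0; case: (eqVneq v a) => //= ->.
  rewrite (asbool_equiv_eq (star_invariant_letter y (p := (a, b)) _)) ?star_refl //.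
  by case: ifP => // _; case: b.
move=> v w vw y /=; rewrite /step /= !addr0.
have [va|va] := eqVneq v a; have [wa|wa] := eqVneq w a; subst => //=.
- rewrite (asbool_equiv_eq (star_invariant_letter y (p := (w, true)) _)) //.
    by rewrite add0r addr0.
  by rewrite /star /= vw orbT.
rewrite (asbool_equiv_eq (star_invariant_letter y (p := (v, true)) _)) //.
  by rewrite add0r addr0.
by rewrite /star /= adj_sym vw orbT.
Qed.

(** The number of [a]-edges, counted with sign, that a path from [h] to [y]
crosses at vertices in [P]. *)
Definition height h y : int := rise h (repr (h^-1 * y)%g).

Lemma height_word h w : height h (h * of_word w)%g = rise h w.
Proof.
by apply: rise_raag_eq; apply/of_wordP; rewrite of_word_repr mulKg.
Qed.

Lemma height_refl h : height h h = 0.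
Proof. by rewrite -[X in height _ X]mulg1 -of_word_nil height_word. Qed.

Lemma height_letter h y p : height h (y * letter p)%g = height h y + step y p.
Proof.
have [w E] := of_word_surj (h^-1 * y)%g.
have -> : y = (h * of_word w)%g by rewrite E mulVKg.
by rewrite -mulgA -[letter p]/(of_word [:: p]) -of_word_mul !height_word
  rise_cat /= addr0.
Qed.

Lemma height_gen h y c :
  height h (y * gen c)%g = height h y + ((c == a) && `[< P y >])%:R.
Proof.
rewrite (height_letter _ _ (c, true)) /step /=.
by case: ifP.
Qed.

Lemma star_invariant_zpow y n : P (y * zpow (gen a) n)%g <-> P y.
Proof.
apply: (@zpow_ind _ (fun z => P z <-> P y)) => [//|z|z].
  by rewrite P_inv ?star_refl.
by rewrite -letter_false star_invariant_letter //= star_refl.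
Qed.

Lemma height_zpow h y c n : c != a \/ ~ P y ->
  height h (y * zpow (gen c) n)%g = height h y.
Proof.
move=> cP; have nP m : c = a -> ~ P (y * zpow (gen c) m)%g.
  by move=> ca; rewrite ca star_invariant_zpow; case: cP => [|//]; rewrite ca eqxx.
have stepP m b : height h (y * zpow (gen c) m * letter (c, b))%g =
    height h (y * zpow (gen c) m)%g.
  rewrite height_letter /step /=; case: eqP => [E|_] /=; last exact: addr0.
  by rewrite asboolF ?addr0 //; exact: nP.
elim: n => [|n IH|n IH]; first by rewrite zpow0 mulg1.
  by rewrite -addn1 PoszD zpowS mulgA (stepP _ true).
by rewrite -addn1 PoszD opprD zpowB1 mulgA -letter_false stepP.
Qed.

Lemma height_zpow_self h y n : P y ->
  height h (y * zpow (gen a) n)%g = height h y + n.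
Proof.
move=> Py; elim: n => [|n IH|n IH]; first by rewrite zpow0 mulg1 addr0.
  rewrite -addn1 PoszD zpowS mulgA height_gen eqxx asboolT ?addrA ?IH //.
  exact/star_invariant_zpow.
rewrite -addn1 PoszD opprD zpowB1 mulgA -letter_false height_letter.
rewrite /step eqxx asboolT ?addrA ?IH //.
exact/star_invariant_zpow.
Qed.

Lemma star_invariant_prod Q (r : seq G) g : {in r, forall v, star a v} ->
  P (g * \prod_(v <- r | Q v) gen v)%g <-> P g.
Proof.
elim: r g => [|c s IH] g rP; first by rewrite big_nil mulg1.
have sP : {in s, forall v, star a v} by move=> v vs; apply: rP; rewrite inE vs orbT.
rewrite big_cons; case: (Q c); last exact: IH.
by rewrite mulgA IH // P_inv // rP // mem_head.
Qed.

Lemma height_prod_notin Q (r : seq G) h g : a \notin r ->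
  height h (g * \prod_(v <- r | Q v) gen v)%g = height h g.
Proof.
elim: r g => [|c s IH] g; first by rewrite big_nil mulg1.
rewrite inE negb_or => /andP[ac as_]; rewrite big_cons; case: (Q c); last exact: IH.
by rewrite mulgA IH // height_gen eq_sym (negbTE ac) addr0.
Qed.

Lemma height_prod Q (r : seq G) h g :
  uniq r -> {in r, forall v, star a v} -> a \in r ->
  height h (g * \prod_(v <- r | Q v) gen v)%g =
    height h g + (Q a && `[< P g >])%:R.
Proof.
elim: r g => [//|c s IH] g /= /andP[cs us] rP.
have sP : {in s, forall v, star a v} by move=> v vs; apply: rP; rewrite inE vs orbT.
rewrite big_cons inE; have [E|ac] /= := eqVneq a c => [_|as_].
  subst c; case: (Q a); last by rewrite height_prod_notin //= addr0.
  by rewrite mulgA height_prod_notin // height_gen eqxx.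
case: (Q c); last exact: IH.
rewrite mulgA IH // height_gen eq_sym (negbTE ac) addr0.
by rewrite (asbool_equiv_eq (P_inv _ _)) // rP // mem_head.
Qed.

End Height.

(** * The metric of the cube complex *)

Section Metric.
Variables (R : realType) (G : sgraph).
Local Notation X := (cpoint R G).
Implicit Types (x y z : X) (g h : raag G) (s : {fset G}) (l : R).

Lemma cpoint_ext x y : base x = base y -> (forall v, coord x v = coord y v) -> x = y.
Proof.
case: x => b c cc ci; case: y => b' c' cc' ci' /= <- /fsfunP E; subst c'.
by congr CPoint; apply: Prop_irrelevance.
Qed.

Lemma coord_ge0 x v : 0 <= coord x v.
Proof. by case/andP: (coord_itv x v). Qed.

Lemma coord_lt1 x v : coord x v < 1.
Proof. by case/andP: (coord_itv x v). Qed.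

Lemma cube_point_exists g s (a : G -> R) :
  clique s -> (forall v, v \in s -> 0 <= a v <= 1) -> exists x, cube_point g s a x.
Proof.
move=> cs a01.
pose c : {fsfun G -> R with 0} := [fsfun v in s => if a v < 1 then a v else 0].
have cE v : c v = if (v \in s) && (a v < 1) then a v else 0.
  by rewrite /c fsfun_fun; case: ifP => //= ->.
have cc : clique (finsupp c).
  move=> u v; rewrite !mem_finsupp !cE.
  by case: ifP => [/andP[us _]|]; case: ifP => [/andP[vs _]|]; rewrite ?eqxx // => *;
    apply: cs.
have ci v : 0 <= c v < 1.
  rewrite cE; case: ifP => [/andP[vs ->]|_]; last by rewrite lexx ltr01.
  by case/andP: (a01 v vs) => ->.
by exists (CPoint (g * \prod_(v <- s | a v == 1%R) gen v)%g cc ci).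
Qed.

Lemma cube_point_self x s : clique s -> {subset finsupp (coord x) <= s} ->
  cube_point (base x) s (coord x) x.
Proof.
move=> cs xs; split=> //.
- by move=> v _; rewrite coord_ge0 ltW // coord_lt1.
- by rewrite big1_seq ?mulg1 // => v; rewrite lt_eqF // coord_lt1.
move=> v; rewrite coord_lt1 andbT; case: ifPn => // vs.
by apply: fsfun_dflt; apply: contra vs; exact: xs.
Qed.

Lemma cube_point_corner g s : clique s -> cube_point g s (fun=> 0) (vertex R g).
Proof.
move=> cs; split=> //= [v _||v]; first by rewrite lexx ler01.
- by rewrite big1_seq ?mulg1 // => v; rewrite eq_sym oner_eq0.
by rewrite fsfun0E; case: ifP.
Qed.

Lemma clique1 (v : G) : clique [fset v]%fset.
Proof. by move=> u w; rewrite !in_fset1 => /eqP-> /eqP->; rewrite eqxx. Qed.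

Lemma cube_point1 g v (a : G -> R) x : cube_point g [fset v]%fset a x <->
  [/\ 0 <= a v <= 1, base x = (if a v == 1 then (g * gen v)%g else g),
      coord x v = (if a v < 1 then a v else 0) & forall u, u != v -> coord x u = 0].
Proof.
split.
  move=> [_ a01 bE cE]; split.
  - by apply: a01; rewrite in_fset1.
  - by rewrite bE big_mkcond big_seq_fset1; case: eqP; rewrite ?mulg1.
  - by rewrite cE in_fset1 eqxx.
  by move=> u uv; rewrite cE in_fset1 (negbTE uv).
move=> [a01 bE cE c0]; split.
- exact: clique1.
- by move=> u; rewrite in_fset1 => /eqP->.
- by rewrite big_mkcond big_seq_fset1 bE; case: eqP; rewrite ?mulg1.
move=> u; rewrite in_fset1; case: eqVneq => [->|uv] //=; exact: c0.
Qed.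

Lemma cube_dist_ge0 s (a b : G -> R) : 0 <= cube_dist s a b.
Proof. exact: sqrtr_ge0. Qed.

Lemma cube_dist_sym s (a b : G -> R) : cube_dist s a b = cube_dist s b a.
Proof.
by rewrite /cube_dist; congr Num.sqrt; apply: eq_bigr => v _; rewrite -sqrrN opprB.
Qed.

Lemma cube_dist1 v (a b : G -> R) : cube_dist [fset v]%fset a b = `|a v - b v|.
Proof. by rewrite /cube_dist big_seq_fset1 sqrtr_sqr. Qed.

Lemma chain_ge0 x y l : chain x y l -> 0 <= l.
Proof.
by elim=> [//|{}x {}y z {}l g s a b _ _ _ IH]; rewrite addr_ge0 ?cube_dist_ge0.
Qed.

Lemma chain_cat x y z l m : chain x y l -> chain y z m -> chain x z (l + m).
Proof.
elim=> [{}x|{}x {}y w {}l g s a b hx hy _ IH] yz; first by rewrite add0r.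
by rewrite -addrA; apply: chain_cons hx hy (IH yz).
Qed.

Lemma chain_cube x y g s a b :
  cube_point g s a x -> cube_point g s b y -> chain x y (cube_dist s a b).
Proof.
by move=> hx hy; rewrite -[cube_dist _ _ _]addr0; apply: chain_cons hx hy (chain_nil _).
Qed.

Lemma chain_rev x y l : chain x y l -> chain y x l.
Proof.
elim=> [{}x|{}x {}y w {}l g s a b hx hy _ IH]; first exact: chain_nil.
by rewrite addrC cube_dist_sym; apply: chain_cat IH (chain_cube hy hx).
Qed.

Lemma chain_edge g v : chain (vertex R g) (vertex R (g * gen v)%g) 1.
Proof.
have h0 := cube_point_corner g (@clique1 v).
have h1 : cube_point g [fset v]%fset (fun=> 1) (vertex R (g * gen v)%g).
  apply/cube_point1; rewrite /= ler01 lexx eqxx ltxx; split=> //.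
  - by rewrite fsfun0E.
  - by move=> u _; rewrite fsfun0E.
by have := chain_cube h0 h1; rewrite cube_dist1 sub0r normrN1.
Qed.

Lemma chain_word g (w : word G) :
  chain (vertex R g) (vertex R (g * of_word w)%g) (size w)%:R.
Proof.
elim: w g => [|[v b] w IH] g; first by rewrite of_word_nil mulg1; exact: chain_nil.
rewrite of_word_cons mulgA /= -add1n natrD; apply: chain_cat (IH _).
case: b; first exact: chain_edge.
rewrite letter_false; apply: chain_rev.
by rewrite -{2}[g](mulgVK (gen v)); apply: chain_edge.
Qed.

Lemma chain_base x :
  chain x (vertex R (base x)) (cube_dist (finsupp (coord x)) (coord x) (fun=> 0)).
Proof.
apply: chain_cube; last exact/cube_point_corner/coord_clique.
by apply: cube_point_self => //; exact: coord_clique.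
Qed.

Lemma chain_exists x y : exists l, chain x y l.
Proof.
have [w E] := of_word_surj ((base x)^-1 * base y)%g.
eexists; apply: chain_cat (chain_base x) (chain_cat _ (chain_rev (chain_base y))).
by rewrite -[base y](mulVKg (base x)) -E; apply: chain_word.
Qed.

Lemma cat0_le_chain x y l : chain x y l -> cat0_dist x y <= l.
Proof.
move=> xy; apply: ge_inf => //; exists 0 => m; exact: chain_ge0.
Qed.

Lemma le_cat0 x y k : (forall l, chain x y l -> k <= l) -> k <= cat0_dist x y.
Proof.
move=> kP; have [l xy] := chain_exists x y.
by apply: lb_le_inf => [|m]; [exists l|exact: kP].
Qed.

Lemma cat0_ge0 x y : 0 <= cat0_dist x y.
Proof. by apply: le_cat0 => l h; exact: (chain_ge0 h). Qed.

Lemma cat0_sym x y : cat0_dist x y = cat0_dist y x.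
Proof.
by apply/eqP; rewrite eq_le; apply/andP; split; apply: le_cat0 => l /chain_rev;
  exact: cat0_le_chain.
Qed.

Lemma cat0_tri x y z : cat0_dist x z <= cat0_dist x y + cat0_dist y z.
Proof.
rewrite -lerBlDr; apply: le_cat0 => l xy; rewrite lerBlDl -lerBlDr.
apply: le_cat0 => m yz; rewrite lerBlDl; exact: cat0_le_chain (chain_cat xy yz).
Qed.

Lemma cat0_cube x y g s a b :
  cube_point g s a x -> cube_point g s b y -> cat0_dist x y <= cube_dist s a b.
Proof. by move=> hx hy; exact: cat0_le_chain (chain_cube hx hy). Qed.

Lemma cat0_vertex g h : cat0_dist (vertex R g) (vertex R h) <= (word_dist g h)%:R.
Proof.
have [w E E'] := word_lengthP (g^-1 * h)%g.
have -> : h = (g * of_word w)%g by rewrite E mulVKg.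
rewrite /word_dist mulKg (_ : word_length _ = size w); last by rewrite E.
exact: cat0_le_chain (chain_word _ _).
Qed.

(** Chains move inside one cube at a time, so estimates on cubes add up. *)
Lemma lipschitz_cat0 (f : X -> R) k : 0 <= k ->
  (forall g s a b x y, cube_point g s a x -> cube_point g s b y ->
     `|f x - f y| <= k * cube_dist s a b) ->
  forall x y, `|f x - f y| <= k * cat0_dist x y.
Proof.
move=> k0 fP x y.
have cP l : chain x y l -> `|f x - f y| <= k * l.
  elim=> [{}x|{}x {}y z {}l g s a b hx hy _ IH]; first by rewrite subrr normr0 mulr0.
  rewrite -(subrK (f y) (f x)) -addrA mulrDr.
  by apply: le_trans (ler_normD _ _) (lerD (fP _ _ _ _ _ _ hx hy) IH).
move: k0; rewrite le_eqVlt => /predU1P[k0|k0].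
  have [l xy] := chain_exists x y.
  by have := cP _ xy; rewrite -k0 !mul0r.
rewrite mulrC -ler_pdivrMr //; apply: le_cat0 => l /cP; rewrite ler_pdivrMr //.
by rewrite mulrC.
Qed.

End Metric.

(** * Heights on the cube complex *)

Section CubeHeight.
Variables (R : realType) (G : sgraph).
Local Notation X := (cpoint R G).
Implicit Types (x y z : X) (g h : raag G) (s : {fset G}) (u v : G).

Lemma clique_star s u : clique s -> u \in s -> {in s, forall v, star u v}.
Proof.
by move=> cs us v vs; rewrite /star; case: eqVneq => //= vu; apply: cs; rewrite // eq_sym.
Qed.

(** The affine extension to cubes of the height with respect to [u] and [P]. *)
Definition ht u (P : raag G -> Prop) h x : R :=
  (height u P h (base x))%:~R + (if `[< P (base x) >] then coord x u else 0).

Lemma ht_cube u P h g s a x : star_invariant u P -> cube_point g s a x ->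
  ht u P h x =
  (height u P h g)%:~R + (if (u \in s) && `[< P g >] then a u else 0).
Proof.
move=> Pinv [cs a01 bE cE]; rewrite /ht bE cE.
have us := clique_star cs.
case: (boolP (u \in s)) => [uis|uis] /=.
  rewrite (height_prod Pinv) ?fset_uniq //; last exact: us.
  rewrite (asbool_equiv_eq (star_invariant_prod Pinv _ _ (us _ uis))).
  rewrite rmorphD /= -addrA; congr (_ + _).
  have /andP[_] := a01 _ uis; rewrite le_eqVlt => /predU1P[->|a1].
    by rewrite eqxx ltxx; case: ifP => _ /=; rewrite ?addr0.
  by rewrite lt_eqF // a1 add0r.
by rewrite height_prod_notin //; case: ifP => _; rewrite addr0.
Qed.

Lemma ht_vertex u P h g : ht u P h (vertex R g) = (height u P h g)%:~R.
Proof. by rewrite /ht /= fsfun0E; case: ifP; rewrite addr0. Qed.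

(** Whether the height changes along the edges labelled [u] of the cube. *)
Definition cube_slope u (P : raag G -> Prop) g s : bool := (u \in s) && `[< P g >].

Lemma ht_cubeB u P h g s a b x y : star_invariant u P ->
  cube_point g s a x -> cube_point g s b y ->
  ht u P h x - ht u P h y = (cube_slope u P g s)%:R * (a u - b u).
Proof.
move=> Pinv hx hy; rewrite (ht_cube _ Pinv hx) (ht_cube _ Pinv hy) -/(cube_slope u P g s).
by case: (cube_slope u P g s); rewrite ?mul1r ?mul0r; lra.
Qed.

Lemma sum_slope_le (r : seq G) s (c : G -> bool) (d : G -> R) : uniq r ->
  (forall u, c u -> u \in s) ->
  \sum_(u <- r) ((c u)%:R * d u) ^+ 2 <= \sum_(u <- s) (d u) ^+ 2.
Proof.
move=> ur cs.
have -> : \sum_(u <- r) ((c u)%:R * d u) ^+ 2 = \sum_(u <- [seq u <- r | c u]) d u ^+ 2.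
  rewrite big_filter [RHS]big_mkcond; apply: eq_bigr => u _.
  by case: (c u); rewrite ?mul1r // mul0r expr0n.
rewrite (perm_big [seq u <- s | (u \in r) && c u]) /=.
  rewrite big_filter big_mkcond; apply: ler_sum => u _.
  by case: ifP => // _; exact: sqr_ge0.
apply: uniq_perm; rewrite ?filter_uniq ?fset_uniq // => u; rewrite !mem_filter.
apply/andP/andP => [[cu ur']|[/andP[ur' cu] _]]; last by [].
by rewrite cu ur'; split=> //; exact: cs.
Qed.

Lemma cauchy_schwarz (r : seq G) (a b : G -> R) :
  (\sum_(u <- r) a u * b u) ^+ 2 <= (\sum_(u <- r) a u ^+ 2) * (\sum_(u <- r) b u ^+ 2).
Proof.
elim: r => [|u r IH]; first by rewrite !big_nil expr0n mulr0.
rewrite !big_cons; move: IH.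
have : 0 <= \sum_(u <- r) a u ^+ 2 by apply: sumr_ge0 => v _; exact: sqr_ge0.
have : 0 <= \sum_(u <- r) b u ^+ 2 by apply: sumr_ge0 => v _; exact: sqr_ge0.
move: (\sum_(u <- r) a u * b u) (\sum_(u <- r) a u ^+ 2) (\sum_(u <- r) b u ^+ 2).
move=> c A B B0 A0 cAB; move: (a u) (b u) => {}a {}b.
have key : 2 * (a * b * c) <= a ^+ 2 * B + A * b ^+ 2.
  have S0 : 0 <= a ^+ 2 * B + A * b ^+ 2.
    by apply: addr_ge0; apply: mulr_ge0 => //; exact: sqr_ge0.
  case: (lerP (a * b * c) 0) => [h|h]; first by apply: (le_trans _ S0); rewrite pmulr_rle0.
  rewrite -ler_sqr ?nnegrE //; last by rewrite mulr_ge0 // ltW.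
  have h1 : (a * b) ^+ 2 * c ^+ 2 <= (a * b) ^+ 2 * (A * B).
    by rewrite ler_wpM2l ?sqr_ge0.
  have h2 := sqr_ge0 (a ^+ 2 * B - A * b ^+ 2).
  nra.
nra.
Qed.

(** Heights with distinct labels are the coordinates of a map to a Euclidean space
that does not increase distances: it projects every cube orthogonally onto a face. *)
Lemma ht_euclid (r : seq G) (P : G -> raag G -> Prop) (h : raag G) x y :
  uniq r -> (forall u, u \in r -> star_invariant u (P u)) ->
  \sum_(u <- r) (ht u (P u) h x - ht u (P u) h y) ^+ 2 <= cat0_dist x y ^+ 2.
Proof.
move=> ur Pinv.
pose e u := ht u (P u) h x - ht u (P u) h y.
pose f z := \sum_(u <- r) e u * ht u (P u) h z.
pose S := \sum_(u <- r) e u ^+ 2.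
have S0 : 0 <= S by apply: sumr_ge0 => u _; exact: sqr_ge0.
have fxy : f x - f y = S.
  by rewrite /f -sumrB; apply: eq_bigr => u _; rewrite -mulrBr -expr2.
have lip : `|f x - f y| <= Num.sqrt S * cat0_dist x y.
  apply: lipschitz_cat0 => [|g s a b {fxy}x' y' hx hy]; first exact: sqrtr_ge0.
  rewrite /cube_dist -sqrtrM // -sqrtr_sqr ler_sqrt; last first.
    by rewrite mulr_ge0 // sumr_ge0 // => u _; exact: sqr_ge0.
  have -> : f x' - f y' =
      \sum_(u <- r) e u * ((cube_slope u (P u) g s)%:R * (a u - b u)).
    rewrite /f -sumrB !big_seq; apply: eq_bigr => u ur'.
    by rewrite -mulrBr (ht_cubeB h (Pinv _ ur') hx hy).
  apply: le_trans (cauchy_schwarz _ _ _) _; apply: ler_wpM2l => //.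
  by apply: sum_slope_le => // u /andP[].
rewrite -/S -[S]sqr_sqrtr // ler_sqr ?nnegrE ?sqrtr_ge0 ?cat0_ge0 //.
move: lip; rewrite fxy ger0_norm // -{1}[S]sqr_sqrtr // expr2.
have := sqrtr_ge0 S; rewrite le_eqVlt => /predU1P[<- _|S1]; first exact: cat0_ge0.
by rewrite ler_pM2l.
Qed.

Lemma ht_lipschitz u P h x y : star_invariant u P ->
  `|ht u P h x - ht u P h y| <= cat0_dist x y.
Proof.
move=> Pinv; rewrite -ler_sqr ?nnegrE ?cat0_ge0 // real_normK ?num_real //.
have := @ht_euclid [:: u] (fun=> P) h x y isT.
by rewrite big_seq1; apply=> v; rewrite inE => /eqP->.
Qed.

(** If no cube contains edges of both kinds, each cube is mapped to an axis of the
plane, where the taxicab and the Euclidean metric agree. *)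
Lemma ht_pm_lipschitz u v P Q h k (c d : R) x y :
  star_invariant u P -> star_invariant v Q -> `|c| <= 1 -> `|d| <= 1 ->
  (forall g s, clique s -> ~~ (cube_slope u P g s && cube_slope v Q g s)) ->
  `|(c * ht u P h x + d * ht v Q k x) - (c * ht u P h y + d * ht v Q k y)|
    <= cat0_dist x y.
Proof.
move=> Pinv Qinv c1 d1 cross; rewrite -[leRHS]mul1r.
pose f z := c * ht u P h z + d * ht v Q k z.
rewrite -!/(f _); move: x y; apply: lipschitz_cat0 => // g s a b x y hx hy; rewrite mul1r.
have one w : w \in s -> `|a w - b w| <= cube_dist s a b.
  move=> ws; rewrite /cube_dist -sqrtr_sqr ler_sqrt.
    by rewrite (big_fsetD1 w) //= lerDl sumr_ge0 // => i _; exact: sqr_ge0.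
  by apply: sumr_ge0 => i _; exact: sqr_ge0.
have -> : f x - f y = c * ((cube_slope u P g s)%:R * (a u - b u)) +
                      d * ((cube_slope v Q g s)%:R * (a v - b v)).
  by rewrite -(ht_cubeB h Pinv hx hy) -(ht_cubeB k Qinv hx hy) /f; ring.
have cs : clique s by case: hx.
move: (cross g s cs) one; rewrite /cube_slope.
case: (u \in s) / boolP => us; case: (v \in s) / boolP => vs;
  case: asboolP => _; case: asboolP => _ //= _ one;
  rewrite ?mul1r ?mul0r ?mulr0 ?addr0 ?add0r ?normr0 ?cube_dist_ge0 // normrM.
all: apply: le_trans (_ : 1 * _ <= _); [by apply: ler_wpM2r => //|rewrite mul1r; exact: one].
Qed.

End CubeHeight.

(** * Standard geodesics *)

Section Lines.
Variables (R : realType) (G : sgraph).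
Local Notation X := (cpoint R G).
Implicit Types (x y z : X) (g h k : raag G) (a b u v w : G) (n m : int).

Lemma gen_cosetP h a g :
  gen_coset h [set gen a] g <-> exists n, g = (h * zpow (gen a) n)%g.
Proof.
split=> [[z zP <-]|[n ->]].
  pose S := [set y | exists n, y = zpow (gen a) n].
  suff [n ->] : S z by exists n.
  apply: zP; split=> [|_ ->]; last by exists 1; rewrite zpow1.
  split=> [|_ _ [n ->] [m ->]]; first by exists 0; rewrite zpow0.
  by exists (n - m); rewrite zpowD zpowN.
exists (zpow (gen a) n) => // H [[H1 HV] Ha].
have {}Ha : H (gen a) by exact: Ha.
have HM (y z : raag G) : H y -> H z -> H (y * z)%g.
  by move=> Hy Hz; rewrite -[z]invgK; apply: (HV) => //; rewrite -[z^-1%g]mul1g; exact: HV.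
by rewrite -[zpow _ n]mul1g; apply: zpow_ind => // y Hy; [exact: HM | exact: HV].
Qed.

Lemma gen_coset2P h v w g : adj v w ->
  gen_coset h [set gen v; gen w] g <->
  exists i j, g = (h * zpow (gen v) i * zpow (gen w) j)%g.
Proof.
move=> vw; have vwC i j := zpow_commute2 i j (genC vw).
split=> [[z zP <-]|[i [j ->]]].
  pose S := [set y | exists i j, y = (zpow (gen v) i * zpow (gen w) j)%g].
  suff [i [j ->]] : S z by exists i, j; rewrite mulgA.
  apply: zP; split=> [|_ [->|->]]; last 2 first.
  - by exists 1, 0; rewrite zpow0 zpow1 mulg1.
  - by exists 0, 1; rewrite zpow0 zpow1 mul1g.
  split=> [|_ _ [i [j ->]] [i' [j' ->]]]; first by exists 0, 0; rewrite !zpow0 mulg1.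
  exists (i - i'), (j - j'); rewrite !zpowD invgM !zpowN -!mulgA; congr (_ * _)%g.
  by rewrite -!zpowN (mulgA (zpow (gen v) _)) (vwC (- i')) -mulgA vwC.
rewrite -mulgA; eexists; last by [].
move=> H [[H1 HV] Hvw].
have Hv : H (gen v) by apply: Hvw; left.
have Hw : H (gen w) by apply: Hvw; right.
have HM (y z : raag G) : H y -> H z -> H (y * z)%g.
  by move=> Hy Hz; rewrite -[z]invgK; apply: (HV) => //; rewrite -[z^-1%g]mul1g; exact: HV.
have Hz (y : raag G) n : H y -> H (zpow y n).
  move=> Hy; rewrite -[zpow _ n]mul1g.
  by apply: zpow_ind => // z Hz; [exact: HM | exact: HV].
by apply: HM; exact: Hz.
Qed.

(** The standard geodesic through [h] in direction [a], given by bases and coordinates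
because heights are computed from these. *)
Definition sline h a : set X :=
  [set x | (exists n, base x = (h * zpow (gen a) n)%g) /\
           forall u, u != a -> coord x u = 0].

Lemma sline_vertex h a g :
  sline h a (vertex R g) <-> exists n, g = (h * zpow (gen a) n)%g.
Proof. by split=> [[]//|gE]; split=> // u _; exact: fsfun0E. Qed.

Lemma sline_zpow h a n : sline h a (vertex R (h * zpow (gen a) n)%g).
Proof. by apply/sline_vertex; exists n. Qed.

Lemma sline_shift h a n : sline (h * zpow (gen a) n)%g a = sline h a.
Proof.
apply/seteqP; split=> x [[m xE] x0]; split=> //.
  by exists (n + m); rewrite zpowD mulgA.
by exists (m - n); rewrite -mulgA -zpowD addrC subrK.
Qed.

Lemma vertex_set_sline h a : vertex_set (sline h a) = gen_coset h [set gen a].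
Proof. by apply/seteqP; split=> g /=; rewrite gen_cosetP /vertex_set /= sline_vertex. Qed.

Lemma sline_cube h a x : sline h a x ->
  cube_point (base x) [fset a]%fset (coord x) x.
Proof.
move=> [_ x0]; apply: cube_point_self; first exact: clique1.
by move=> u; rewrite mem_finsupp in_fset1; apply: contra_neqT => /x0.
Qed.

Lemma cat0_sline_base h a x : sline h a x -> cat0_dist x (vertex R (base x)) <= coord x a.
Proof.
move=> xl; have c0 := @cube_point_corner R _ (base x) _ (@clique1 _ a).
apply: le_trans (cat0_cube (sline_cube xl) c0) _.
by rewrite cube_dist1 subr0 ger0_norm // coord_ge0.
Qed.

(** With this set the height is the exponent sum of the label. *)
Definition everywhere : raag G -> Prop := fun=> True.

Lemma everywhere_invariant u : star_invariant u everywhere.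
Proof. by []. Qed.

Lemma star_coset_invariant a h : star_invariant a (star_coset a h).
Proof.
move=> y c ac; have yc := star_coset_gen y ac.
split=> hy; apply: star_coset_trans hy _ => //; exact: star_coset_sym.
Qed.

(** The line then has no edge at which the height changes. *)
Lemma ht_sline_const a (P : raag G -> Prop) h k b x : star_invariant a P ->
  b != a \/ ~ P k -> sline k b x -> ht a P h x = (height a P h k)%:~R.
Proof.
move=> Pinv bP [[n xE] x0]; rewrite /ht xE height_zpow //.
case: eqVneq bP x0 => [->|ba] bP x0; last by rewrite x0 1?eq_sym // if_same addr0.
case: bP => // nP; rewrite asboolF ?addr0 //.
by rewrite (star_invariant_zpow Pinv).
Qed.

Lemma ht_sline a (P : raag G -> Prop) h n x : star_invariant a P -> P h ->
  base x = (h * zpow (gen a) n)%g -> ht a P h x = n%:~R + coord x a.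
Proof.
move=> Pinv Ph xE; rewrite /ht xE (height_zpow_self Pinv) // height_refl // add0r.
by rewrite asboolT // star_invariant_zpow.
Qed.

Lemma ht_zpow a (P : raag G -> Prop) h n : star_invariant a P -> P h ->
  ht a P h (vertex R (h * zpow (gen a) n)%g) = n%:~R.
Proof. by move=> Pinv Ph; rewrite (ht_sline (n := n)) //= fsfun0E addr0. Qed.

Lemma zpow_gen_height a n : height a everywhere 1%g (zpow (gen a) n) = n.
Proof.
by rewrite -[zpow _ _]mul1g (height_zpow_self (@everywhere_invariant a)) //
  height_refl // add0r.
Qed.

(** The exponent of [a] is a 1-Lipschitz function, hence the lower bound. *)
Lemma word_length_zpow a n : word_length (zpow (gen a) n) = `|n|%N.
Proof.
apply/eqP; rewrite eqn_leq; apply/andP; split.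
  have g1 : (word_length (gen a) <= 1)%N by exact: (word_length_le [:: (a, true)]).
  have e1 : (word_length (1%g : raag G) <= 0)%N by exact: (@word_length_le G [::]).
  have pos (m : nat) : (word_length (zpow (gen a) m) <= m)%N.
    elim: m => [|m IH]; first by rewrite zpow0.
    rewrite -addn1 PoszD zpowS; apply: leq_trans (word_length_mul _ _) _.
    exact: leq_add.
  case: n => m; first exact: pos.
  by rewrite NegzE zpowN word_length_inv; exact: pos.
have := ht_lipschitz 1%g (vertex R (1 * zpow (gen a) n)%g) (vertex R 1%g)
  (@everywhere_invariant a).
rewrite cat0_sym => /le_trans/(_ (cat0_vertex _ _ _)).
rewrite ht_zpow // ht_vertex height_refl // subr0 /word_dist invg1 !mul1g.
by rewrite -intr_norm -pmulrn ler_nat.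
Qed.

Lemma word_dist_zpow h a n m :
  word_dist (h * zpow (gen a) n)%g (h * zpow (gen a) m)%g = `|n - m|%N.
Proof.
rewrite /word_dist invgM -mulgA mulKg -zpowN -zpowD word_length_zpow.
by lia.
Qed.

Lemma zpow_mul_gen a v n m : (zpow (gen a) n * gen v)%g = zpow (gen a) m -> v = a.
Proof.
move=> E; apply/eqP; apply: contraT => va.
have := height_gen (@everywhere_invariant v) 1%g (zpow (gen a) n) v.
rewrite E -[zpow (gen a) m]mul1g -[X in height _ _ _ X + _]mul1g.
rewrite !height_zpow ?height_refl //; try by left; rewrite eq_sym.
by rewrite eqxx asboolT.
Qed.

Lemma sline_edge h a n x : edge (h * zpow (gen a) n)%g (h * zpow (gen a) (n + 1))%g x ->
  sline h a x.
Proof.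
have nS : (h * zpow (gen a) (n + 1) = h * zpow (gen a) n * gen a)%g.
  by rewrite zpowS mulgA.
case=> v [t [[E /cube_point1[_ bE _ c0]]|[E _]]].
  move: E; rewrite -mulgA => /mulgI/esym/zpow_mul_gen E; subst v; split=> //.
  rewrite bE; case: ifP => _; last by exists n.
  by exists (n + 1); rewrite nS.
have := E; rewrite -mulgA => /mulgI/esym/zpow_mul_gen va; subst v.
move: E; rewrite nS -mulgA -[X in X = _]mulg1 => /mulgI /esym E.
have := @zpow_gen_height a 2.
by rewrite -[zpow _ 2]/(gen a ^+ 2)%g expg2 E -(zpow0 (gen a)) zpow_gen_height.
Qed.

Lemma edgeC g h : edge g h = edge h g :> set X.
Proof.
by apply/seteqP; split=> x [v [t H]]; exists v, t; case: H; [right|left|right|left].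
Qed.

Lemma sline_standard h a : standard_geodesic (sline h a).
Proof.
split; last by exists h, a; exact: vertex_set_sline.
exists (fun n => (h * zpow (gen a) n)%g); split; first exact: word_dist_zpow.
apply/seteqP; split=> x; last by case=> n _; exact: sline_edge.
move=> xl; have := sline_cube xl; case: (xl) => -[n xE] _ xc; exists n => //.
by exists a, (coord x); left; rewrite -xE zpowS mulgA -xE.
Qed.

(** A geodesic of the 1-skeleton that runs through exactly the elements of [h <a>]
enumerates them in their order or in the opposite one, as it preserves distances. *)
Lemma standard_geodesicP (l : set X) :
  standard_geodesic l -> exists h a, l = sline h a.
Proof.
move=> [[c [cd lE]] [h [a lV]]]; exists h, a.
have dist1 n : exists p, c (n + 1) = (c n * letter p)%g.
  have [wd wE wS] := word_lengthP ((c n)^-1 * c (n + 1))%g.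
  have : word_dist (c n) (c (n + 1)) = 1%N by rewrite cd opprD addNKr.
  rewrite /word_dist -wS; case: wd wE {wS} => [|p [|]] //= wE _.
  by exists p; rewrite -[letter p]/(of_word [:: p]) wE mulVKg.
have cl n : vertex_set l (c n).
  rewrite /vertex_set /= lE; exists n => //; have [[v [|]] E] := dist1 n.
    exists v, (fun=> 0); left; split=> //.
    exact/cube_point_corner/clique1.
  exists v, (fun=> 1); right; rewrite E letter_false mulgVK; split=> //.
  apply/cube_point1; rewrite /= ler01 lexx eqxx ltxx mulgVK; split=> //.
  - exact: fsfun0E.
  - by move=> u _; exact: fsfun0E.
have cE n : exists m, c n = (h * zpow (gen a) m)%g.
  by apply/gen_cosetP; rewrite -lV.
have lc g : vertex_set l g -> exists n, g = c n.
  rewrite /vertex_set /= lE => -[n _ [v [t H]]].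
  case: H => -[E /cube_point1[/= _ -> _ _]]; case: ifP => _.
  - by exists (n + 1).
  - by exists n.
  - by exists n.
  - by exists (n + 1).
apply/seteqP; split=> x.
  rewrite lE => -[n _]; have [m cm] := cE n; have [m' cm'] := cE (n + 1).
  have := cd n (n + 1); rewrite cm cm' word_dist_zpow => mm.
  have [->|->] : m' = m + 1 \/ m = m' + 1 by lia.
    exact: sline_edge.
  by rewrite edgeC; exact: sline_edge.
move=> xl; have xc := sline_cube xl; case: xl => -[n xE] _.
have [m mE] : exists m, (h * zpow (gen a) n)%g = c m.
  by apply: lc; rewrite lV; apply/gen_cosetP; exists n.
have [m' mE'] : exists m, (h * zpow (gen a) (n + 1))%g = c m.
  by apply: lc; rewrite lV; apply/gen_cosetP; exists (n + 1).
have := cd m m'; rewrite -mE -mE' word_dist_zpow => mm.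
have ed : edge (c m) (c m') x.
  by exists a, (coord x); left; rewrite -mE -mE' zpowS mulgA -xE.
rewrite lE; have [E|E] : m' = m + 1 \/ m = m' + 1 by lia.
  by exists m => //; rewrite -E.
by exists m' => //; rewrite -E edgeC.
Qed.

End Lines.

(** * Parallelism *)

Section HausdorffTheory.
Variables (R : realType) (T : Type) (d : T -> T -> R).
Hypothesis d_sym : forall x y, d x y = d y x.
Hypothesis d_tri : forall x y z, d x z <= d x y + d y z.

Lemma finite_hausdorff_sym A B : finite_hausdorff d A B -> finite_hausdorff d B A.
Proof.
move=> [D [AB BA]]; exists D; split=> x.
  by move=> /BA[y Ay xy]; exists y; rewrite // d_sym.
by move=> /AB[y By xy]; exists y; rewrite // d_sym.
Qed.

Lemma finite_hausdorff_trans A B C :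
  finite_hausdorff d A B -> finite_hausdorff d B C -> finite_hausdorff d A C.
Proof.
move=> [D [AB BA]] [E [BC CB]]; exists (D + E); split=> x.
  move=> /AB[y /BC[z Cz yz] xy]; exists z => //.
  by apply: le_trans (d_tri _ y _) _; exact: lerD.
move=> /CB[y /BA[z Az yz] xy]; exists z => //.
by apply: le_trans (d_tri _ y _) _; exact: lerD.
Qed.

End HausdorffTheory.

Section Parallel.
Variables (R : realType) (G : sgraph).
Local Notation X := (cpoint R G).
Local Notation wd := (@wdist R G).
Implicit Types (x y z : X) (g h k : raag G) (a b u v w : G) (n m : int).

Lemma wdist_sym g h : wd g h = wd h g.
Proof. by rewrite /wdist word_dist_sym. Qed.

Lemma wdist_tri g h k : wd g k <= wd g h + wd h k.
Proof. by rewrite /wdist -natrD ler_nat word_dist_tri. Qed.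

(** The height of [h <a>] is unbounded on this geodesic, but it would be constant on
[k <b>] if the conclusion failed. *)
Lemma sline_near h a k b (D : R) :
  (forall n, exists2 y, sline k b y &
     cat0_dist (vertex R (h * zpow (gen a) n)%g) y <= D) ->
  a = b /\ star_coset a h k.
Proof.
move=> near; have Pinv := @star_coset_invariant _ a h.
apply: contrapT => not_par.
have ht_k y : sline k b y ->
    ht a (star_coset a h) h y = (height a (star_coset a h) h k)%:~R.
  apply: ht_sline_const => //; case: (eqVneq b a) => [ba|]; last by left.
  by right => hk; apply: not_par.
pose c : R := (height a (star_coset a h) h k)%:~R.
have [y /ht_k hy dy] := near (Num.floor (D + c) + 1).
have := le_trans (ht_lipschitz h _ _ Pinv) dy.
rewrite hy -/c (ht_zpow _ _ Pinv (star_coset_refl _ _)).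
by have := floorD1_gt (D + c) => lt /(le_trans (ler_norm _)); lra.
Qed.

(** Right multiplication by an element that commutes with [a] moves the points of
[h <a>] by its length. *)
Lemma star_coset_hausdorff h k a : star_coset a h k ->
  hausdorff_le wd (wd h k) (gen_coset h [set gen a]) (gen_coset k [set gen a]).
Proof.
move=> [w /star_word_commute aw ->].
have dE n : word_dist (h * zpow (gen a) n)%g (h * of_word w * zpow (gen a) n)%g =
            word_dist h (h * of_word w)%g.
  have com : (of_word w * zpow (gen a) n = zpow (gen a) n * of_word w)%g.
    by have := zpow_commute n (commute_sym aw).
  by rewrite /word_dist -(mulgA h) com (mulgA h) !mulKg.
split=> _ /gen_cosetP[n ->].
  exists (h * of_word w * zpow (gen a) n)%g; first by apply/gen_cosetP; exists n.
  by rewrite /wdist dE.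
exists (h * zpow (gen a) n)%g; first by apply/gen_cosetP; exists n.
by rewrite /wdist dE.
Qed.

(** A point of a geodesic is within distance 1 of one of its vertices, and the word metric
dominates the CAT(0) metric. *)
Lemma parallel_of_vertices h k a b :
  finite_hausdorff wd (gen_coset h [set gen a]) (gen_coset k [set gen b]) ->
  parallel (sline h a : set X) (sline k b).
Proof.
have half h' k' a' b' D x :
    (forall g, gen_coset h' [set gen a'] g ->
       exists2 g', gen_coset k' [set gen b'] g' & wd g g' <= D) ->
    sline h' a' x -> exists2 y, sline k' b' y & cat0_dist x y <= D + 1.
  move=> hD xl; have [] := hD (base x).
    by apply/gen_cosetP; case: xl.
  move=> g /gen_cosetP gE gD; exists (vertex R g); first exact/sline_vertex.
  apply: le_trans (cat0_tri _ (vertex R (base x)) _) _; rewrite addrC; apply: lerD.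
    exact: le_trans (cat0_vertex _ _ _) gD.
  by apply: le_trans (cat0_sline_base xl) _; rewrite ltW // coord_lt1.
move=> [D [hk kh]]; exists (D + 1); split=> x xl; first exact: half hk xl.
have kh' g : gen_coset k [set gen b] g ->
    exists2 g', gen_coset h [set gen a] g' & wd g g' <= D.
  by move=> /kh[g' hg' gg']; exists g'; rewrite // wdist_sym.
by have [y yl xy] := half _ _ _ _ _ _ kh' xl; exists y; rewrite // cat0_sym.
Qed.

Lemma parallelP h k a b :
  parallel (sline h a : set X) (sline k b) <-> a = b /\ star_coset a h k.
Proof.
split=> [[D [hk _]]|[<- hk]].
  by apply: (@sline_near _ _ _ _ D) => n; apply: hk; exact: sline_zpow.
by apply: parallel_of_vertices; exists (wd h k); exact: star_coset_hausdorff.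
Qed.

Lemma vertices_of_parallel h k a b :
  parallel (sline h a : set X) (sline k b) ->
  finite_hausdorff wd (gen_coset h [set gen a]) (gen_coset k [set gen b]).
Proof.
by move/parallelP => [<- hk]; exists (wd h k); exact: star_coset_hausdorff.
Qed.

Lemma parallel_sym (l l' : set X) : parallel l l' -> parallel l' l.
Proof. by apply: finite_hausdorff_sym; exact: cat0_sym. Qed.

Lemma parallel_trans (l l' l'' : set X) : parallel l l' -> parallel l' l'' -> parallel l l''.
Proof. by apply: finite_hausdorff_trans; exact: cat0_tri. Qed.

Lemma parallel_refl (l : set X) : parallel l l.
Proof.
have dxx x : cat0_dist x x <= 0 by exact/cat0_le_chain/chain_nil.
by exists 0; split=> x lx; exists x.
Qed.

Lemma represents_standard (l : set X) (c : parallel_class R G) :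
  represents l c -> exists h a, l = sline h a.
Proof.
case: c => c cP; rewrite /represents /=; have /asboolP[l0 _ ->] := cP.
by case=> /standard_geodesicP.
Qed.

Lemma represents_parallel (l l' : set X) (c : parallel_class R G) :
  represents l c -> represents l' c -> parallel l l'.
Proof.
case: c => c cP; rewrite /represents /=; have /asboolP[l0 _ ->] := cP.
move=> [_ ll] [_ ll']; apply: parallel_trans ll'; exact: parallel_sym.
Qed.

Lemma represents_trans (l : set X) h a (c : parallel_class R G) :
  represents l c -> parallel l (sline h a) -> represents (sline h a) c.
Proof.
case: c => c cP; rewrite /represents /=; have /asboolP[l0 _ ->] := cP.
move=> [_ ll] ll'; split; first exact: sline_standard.
exact: parallel_trans ll'.
Qed.

Lemma represents_exists (c : parallel_class R G) : exists h a, represents (sline h a) c.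
Proof.
case: c => c cP; rewrite /represents /=; have /asboolP[l0 l0s ->] := cP.
have [h [a E]] := standard_geodesicP l0s.
by exists h, a; rewrite -E; split=> //; exact: parallel_refl.
Qed.

Lemma class_exists h a : exists c : parallel_class R G, represents (sline h a) c.
Proof.
pose C := [set l' : set X | standard_geodesic l' /\ parallel (sline h a) l'].
have cP : `[< is_parallel_class C >].
  by apply/asboolP; exists (sline h a) => //; exact: sline_standard.
exists (exist (fun c : set (set X) => `[< is_parallel_class c >]) C cP).
split; first exact: sline_standard.
exact: parallel_refl.
Qed.

Lemma represents_eq (l l' : set X) (c c' : parallel_class R G) :
  represents l c -> represents l' c' -> parallel l l' -> c = c'.
Proof.
move=> lc lc' ll'; apply: val_inj; move: lc lc'; rewrite /represents.
case: c => c cP /=; case: c' => c' cP' /=.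
have /asboolP[l0 _ ->] := cP; have /asboolP[l1 _ ->] := cP'.
move=> [_ l0l] [_ l1l'].
have l01 : parallel l0 l1.
  by apply: parallel_trans l0l (parallel_trans ll' (parallel_sym l1l')).
apply/seteqP; split=> m [ms] p; split=> //.
  exact: parallel_trans (parallel_sym l01) p.
exact: parallel_trans l01 p.
Qed.

End Parallel.

(** * The induced map *)

Section Induced.
Variables (R : realType) (G L : sgraph) (phi : raag G -> raag L).
Hypothesis hphi : qi_embedding R phi.

Lemma qi_hausdorff (A B : set (raag G)) :
  finite_hausdorff (@wdist R G) A B <->
  finite_hausdorff (@wdist R L) (phi @` A) (phi @` B).
Proof.
have [K [C [K1 C0 qi]]] := hphi; have K0 : 0 < K by apply: lt_le_trans K1.
split=> [[D [AB BA]]|[D [AB BA]]].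
  have up g h : wdist R g h <= D -> wdist R (phi g) (phi h) <= K * D + C.
    by move=> gh; have /andP[_] := qi g h; move/le_trans; apply;
      rewrite lerD2r ler_pM2l.
  exists (K * D + C); split=> _ [g gA <-].
    by have [h hB gh] := AB g gA; exists (phi h); [exists h | exact: up].
  by have [h hB gh] := BA g gA; exists (phi h); [exists h | exact: up].
have down g h : wdist R (phi g) (phi h) <= D -> wdist R g h <= K * (D + C).
  move=> gh; have /andP[qgh _] := qi g h.
  by rewrite -ler_pdivrMl //; have := le_trans qgh gh; lra.
exists (K * (D + C)); split=> g gA.
  have [|_ [h hB <-] gh] := AB (phi g); first by exists g.
  by exists h => //; exact: down.
have [|_ [h hB <-] gh] := BA (phi g); first by exists g.
by exists h => //; exact: down.
Qed.

Lemma weakly_stable_induces : weakly_stable R phi ->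
  exists f : ext_graph R G -> ext_graph R L, induces phi f.
Proof.
move=> ws.
have /choice[f fP] : forall c : ext_graph R G, exists d : ext_graph R L,
    forall l, represents l c -> exists2 l', represents l' d &
      finite_hausdorff (@wdist R L) (phi @` vertex_set l) (vertex_set l').
  move=> c; have [h [a hc]] := represents_exists c.
  have [l' /standard_geodesicP[k [b ->]] ll'] := ws _ (sline_standard R h a).
  have [d kd] := class_exists R k b; exists d => l lc; exists (sline k b) => //.
  apply: finite_hausdorff_trans ll'; first exact: wdist_tri.
  apply/qi_hausdorff; have := represents_parallel lc hc.
  have [h' [a' ->]] := represents_standard lc.
  by rewrite !vertex_set_sline; exact: vertices_of_parallel.
by exists f => c l; exact: fP.
Qed.

Lemma induces_injective (f : ext_graph R G -> ext_graph R L) :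
  induces phi f -> injective f.
Proof.
move=> fP c c' ff.
have [h [a hc]] := represents_exists c; have [k [b kc]] := represents_exists c'.
have [l lc hl] := fP _ _ hc; have [l' lc' kl] := fP _ _ kc.
apply: (represents_eq hc kc); apply: parallel_of_vertices; apply/qi_hausdorff.
rewrite -!(vertex_set_sline R).
apply: finite_hausdorff_trans hl _; first exact: wdist_tri.
apply: finite_hausdorff_trans (finite_hausdorff_sym _ kl); try exact: wdist_tri.
  rewrite -ff in lc'; have := represents_parallel lc lc'.
  have [h' [a' ->]] := represents_standard lc.
  have [k' [b' ->]] := represents_standard lc'.
  by rewrite !vertex_set_sline; exact: vertices_of_parallel.
exact: wdist_sym.
Qed.

End Induced.

(** * Plane geometry *)

Section Plane.
Variable R : realType.
Implicit Types (p q r : R * R) (t : R).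

Definition segment_point p q t : R * R :=
  (p.1 + t * (q.1 - p.1), p.2 + t * (q.2 - p.2)).

Lemma eucl_dist_ge0 p q : 0 <= eucl_dist p q.
Proof. exact: sqrtr_ge0. Qed.

Lemma sqr_eucl_dist p q : eucl_dist p q ^+ 2 = (p.1 - q.1) ^+ 2 + (p.2 - q.2) ^+ 2.
Proof. by rewrite sqr_sqrtr // addr_ge0 ?sqr_ge0. Qed.

Lemma eucl_dist_sym p q : eucl_dist p q = eucl_dist q p.
Proof. by rewrite /eucl_dist -sqrrN opprB -[X in _ + X]sqrrN opprB. Qed.

Lemma eucl_segment p q t : 0 <= t <= 1 ->
  eucl_dist p (segment_point p q t) + eucl_dist (segment_point p q t) q = eucl_dist p q.
Proof.
move=> /andP[t0 t1].
have -> : eucl_dist p (segment_point p q t) = t * eucl_dist p q.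
  rewrite -[t in RHS](ger0_norm t0) -sqrtr_sqr -sqrtrM ?sqr_ge0 //.
  by congr Num.sqrt => /=; ring.
have t10 : 0 <= 1 - t by rewrite subr_ge0.
have -> : eucl_dist (segment_point p q t) q = (1 - t) * eucl_dist p q.
  rewrite -[1 - t](ger0_norm t10) -sqrtr_sqr -sqrtrM ?sqr_ge0 //.
  by congr Num.sqrt => /=; ring.
by ring.
Qed.

(** A distance function on a convex set is bounded by the Euclidean one if it is so
on each slab between consecutive integral level lines of [c]: cut a segment where
it meets such a line. *)
Lemma slab_cut (D : R * R -> R * R -> R) (S : R * R -> Prop) (c : R * R -> R) :
  (forall p q, D p q = D q p) -> (forall p q r, D p r <= D p q + D q r) ->
  (forall p q t, S p -> S q -> 0 <= t <= 1 -> S (segment_point p q t)) ->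
  (forall p q t, c (segment_point p q t) = c p + t * (c q - c p)) ->
  (forall (m : int) p q, S p -> S q -> m%:~R <= c p <= m%:~R + 1 ->
     m%:~R <= c q <= m%:~R + 1 -> D p q <= eucl_dist p q) ->
  forall p q, S p -> S q -> D p q <= eucl_dist p q.
Proof.
move=> D_sym D_tri S_seg c_seg slab.
have ind (k : nat) (m : int) p q : S p -> S q -> m%:~R <= c p -> c p <= c q ->
    c q <= m%:~R + k.+1%:R -> D p q <= eucl_dist p q.
  elim: k m p q => [|k IH] m p q Sp Sq mp pq qm.
    by apply: (slab m) => //; apply/andP; split=> //; lra.
  case: (lerP (c q) (m%:~R + k.+1%:R)) => [|qk]; first exact: IH.
  have kE : (m + k.+1)%:~R = m%:~R + k.+1%:R :> R by rewrite rmorphD /= -pmulrn.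
  have kS : k.+2%:R = k.+1%:R + 1 :> R by rewrite -natr1.
  case: (lerP (m%:~R + k.+1%:R) (c p)) => [pk|pk].
    by apply: (slab (m + k.+1)) => //; rewrite kE; apply/andP; split; lra.
  pose t := (m%:~R + k.+1%:R - c p) / (c q - c p).
  have cpq : 0 < c q - c p by lra.
  have t01 : 0 <= t <= 1.
    by rewrite /t ler_pdivrMr // ler_pdivlMr // mul0r mul1r; apply/andP; split; lra.
  have Sr := S_seg _ _ _ Sp Sq t01.
  have cr : c (segment_point p q t) = m%:~R + k.+1%:R.
    by rewrite c_seg /t divfK ?gt_eqF //; lra.
  rewrite -(eucl_segment p q t01); apply: le_trans (D_tri _ (segment_point p q t) _) _.
  apply: lerD; first by apply: (IH m) => //; rewrite cr; lra.
  by apply: (slab (m + k.+1)) => //; rewrite kE ?cr; apply/andP; split; lra.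
have le p q : S p -> S q -> c p <= c q -> D p q <= eucl_dist p q.
  move=> Sp Sq pq; apply: (ind (Num.truncn (c q - (Num.floor (c p))%:~R)) (Num.floor (c p))) => //.
    exact: floor_le.
  by have := truncnS_gt (c q - (Num.floor (c p))%:~R) => lt; lra.
move=> p q Sp Sq; case: (lerP (c p) (c q)) => [|/ltW] pq; first exact: le.
by rewrite D_sym eucl_dist_sym; exact: le.
Qed.

Lemma grid_cut (D : R * R -> R * R -> R) :
  (forall p q, D p q = D q p) -> (forall p q r, D p r <= D p q + D q r) ->
  (forall (m n : int) p q,
     m%:~R <= p.1 <= m%:~R + 1 -> m%:~R <= q.1 <= m%:~R + 1 ->
     n%:~R <= p.2 <= n%:~R + 1 -> n%:~R <= q.2 <= n%:~R + 1 ->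
     D p q <= eucl_dist p q) ->
  forall p q, D p q <= eucl_dist p q.
Proof.
move=> D_sym D_tri square p q.
apply: (@slab_cut D (fun=> True) fst) => // m p' q' _ _ hp hq.
pose S r := m%:~R <= r.1 <= m%:~R + 1.
apply: (@slab_cut D S snd) => // [p1 q1 t|n p1 q1 Sp Sq]; last exact: (square m n).
rewrite /S /= => /andP[? ?] /andP[? ?] /andP[? ?]; apply/andP; split; nra.
Qed.

(** The distances of [f t] to [f 0] and [f 1] give the scalar product of [f t - f 0] with
the unit vector [f 1 - f 0], and equality holds in the Cauchy-Schwarz inequality. *)
Lemma line_affine (f : R -> R * R) :
  (forall s t, eucl_dist (f s) (f t) = `|s - t|) ->
  exists u : R * R, u.1 ^+ 2 + u.2 ^+ 2 = 1 /\
    forall t, f t = ((f 0).1 + t * u.1, (f 0).2 + t * u.2).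
Proof.
move=> fd.
have sq s t : ((f s).1 - (f t).1) ^+ 2 + ((f s).2 - (f t).2) ^+ 2 = (s - t) ^+ 2.
  by rewrite -sqr_eucl_dist fd real_normK ?num_real.
exists ((f 1).1 - (f 0).1, (f 1).2 - (f 0).2); split.
  by have := sq 1 0; rewrite /= subr0 expr1n.
move=> t; have := sq 1 0; have := sq t 0; have := sq t 1.
case: (f t) (f 0) (f 1) => [x y] [x0 y0] [x1 y1] /= h1 h2 h3.
have : (x - (x0 + t * (x1 - x0))) ^+ 2 + (y - (y0 + t * (y1 - y0))) ^+ 2 = 0.
  have dot : (x - x0) * (x1 - x0) + (y - y0) * (y1 - y0) = t by lra.
  have -> : (x - (x0 + t * (x1 - x0))) ^+ 2 + (y - (y0 + t * (y1 - y0))) ^+ 2 =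
    ((x - x0) ^+ 2 + (y - y0) ^+ 2) + t ^+ 2 * ((x1 - x0) ^+ 2 + (y1 - y0) ^+ 2)
    - 2 * t * ((x - x0) * (x1 - x0) + (y - y0) * (y1 - y0)) by ring.
  by rewrite dot h2 h3; ring.
move/eqP; rewrite paddr_eq0 ?sqr_ge0 // !sqrf_eq0 !subr_eq0 => /andP[/eqP<- /eqP<-].
by [].
Qed.

Lemma dot_le (a1 a2 b1 b2 d e : R) : 0 <= d -> 0 <= e ->
  a1 ^+ 2 + a2 ^+ 2 <= d ^+ 2 -> b1 ^+ 2 + b2 ^+ 2 <= e ^+ 2 ->
  a1 * b1 + a2 * b2 <= d * e.
Proof.
move=> d0 e0 ad be; case: (lerP (a1 * b1 + a2 * b2) 0) => [h|h].
  by apply: le_trans h _; exact: mulr_ge0.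
rewrite -ler_sqr ?nnegrE; last exact: mulr_ge0; last exact: ltW.
have A0 : 0 <= a1 ^+ 2 + a2 ^+ 2 by rewrite addr_ge0 ?sqr_ge0.
have B0 : 0 <= b1 ^+ 2 + b2 ^+ 2 by rewrite addr_ge0 ?sqr_ge0.
have := ler_pM A0 B0 ad be; have := sqr_ge0 (a1 * b2 - a2 * b1).
by rewrite exprMn => h1; apply: le_trans; lra.
Qed.

Lemma eucl_dist_tri p q r : eucl_dist p r <= eucl_dist p q + eucl_dist q r.
Proof.
have pq0 := eucl_dist_ge0 p q; have qr0 := eucl_dist_ge0 q r.
rewrite -ler_sqr ?nnegrE ?addr_ge0 ?eucl_dist_ge0 // sqrrD !sqr_eucl_dist.
have := dot_le pq0 qr0 (_ : (p.1 - q.1) ^+ 2 + (p.2 - q.2) ^+ 2 <= _)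
  (_ : (q.1 - r.1) ^+ 2 + (q.2 - r.2) ^+ 2 <= _).
by rewrite !sqr_eucl_dist => /(_ (lexx _) (lexx _)) h; lra.
Qed.

(** If [f] grows at unit speed along a quasiline, a function whose sum with [f] and
difference from [f] are both Lipschitz is bounded there. *)
Lemma transverse_bounded (f g : R * R -> R) (E : R) (p : int -> R * R) :
  (forall x y, `|(f x + g x) - (f y + g y)| <= eucl_dist x y) ->
  (forall x y, `|(f x - g x) - (f y - g y)| <= eucl_dist x y) ->
  (forall n, `|f (p n) - n%:~R| <= E) ->
  (forall n m, eucl_dist (p n) (p m) <= `|n - m|%:~R + 2 * E) ->
  forall n, `|g (p n) - g (p 0)| <= 4 * E.
Proof.
move=> sum dif fp pd n.
have := fp n; have := fp 0; have := pd n 0; have := sum (p n) (p 0).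
have := dif (p n) (p 0); rewrite subr0 intr_norm !ler_norml.
move=> /andP[? ?] /andP[? ?] pn /andP[? ?] /andP[? ?]; apply/andP; move: pn.
case: (lerP 0 (n%:~R : R)) => n0; [rewrite ger0_norm //|rewrite ltr0_norm //] => pn;
  by split; lra.
Qed.

(** Two functions that grow at unit speed along quasilines of the plane cannot both
have Lipschitz sum and difference: their asymptotic gradients would be unit vectors
with sum and difference of norm at most 1, against the parallelogram law. *)
Lemma plane_contradiction (f1 f2 : R * R -> R) (E : R) (p q : int -> R * R) :
  (forall x y, `|(f1 x + f2 x) - (f1 y + f2 y)| <= eucl_dist x y) ->
  (forall x y, `|(f1 x - f2 x) - (f1 y - f2 y)| <= eucl_dist x y) ->
  (forall n, `|f1 (p n) - n%:~R| <= E) -> (forall n, `|f2 (q n) - n%:~R| <= E) ->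
  (forall n m, eucl_dist (p n) (p m) <= `|n - m|%:~R + 2 * E) ->
  (forall n m, eucl_dist (q n) (q m) <= `|n - m|%:~R + 2 * E) -> False.
Proof.
move=> sum_lip dif_lip fp fq pd qd.
have E0 : 0 <= E by apply: le_trans (fp 0).
pose C := 10 * E + `|f2 (p 0)| + `|f1 (q 0)| + eucl_dist (p 0) (q 0).
have ? := normr_ge0 (f2 (p 0)); have ? := normr_ge0 (f1 (q 0)).
have ? := eucl_dist_ge0 (p 0) (q 0).
have C0 : 0 <= C by rewrite /C; lra.
pose n : int := Posz (Num.truncn (11 * C)).+1.
have nC : 11 * C < n%:~R by rewrite -pmulrn; exact: truncnS_gt.
pose N : R := n%:~R; rewrite -/N in nC.
have N0 : 0 < N by lra.
have CN : 0 <= 2 * N - C by lra.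
have NC : 0 <= N + C by lra.
have k1 : 0 < (N - 11 * C) * N by rewrite mulr_gt0 //; lra.
have k2 : 0 <= (N - 11 * C) * C by rewrite mulr_ge0 //; lra.
have k3 : 0 <= C * C by rewrite mulr_ge0.
have flat_p m : `|f2 (p m)| <= `|f2 (p 0)| + 4 * E.
  have := transverse_bounded sum_lip dif_lip fp pd m.
  by have := ler_normD (f2 (p m) - f2 (p 0)) (f2 (p 0)); rewrite subrK; lra.
have flat_q m : `|f1 (q m)| <= `|f1 (q 0)| + 4 * E.
  have sum' x y : `|(f2 x + f1 x) - (f2 y + f1 y)| <= eucl_dist x y.
    by rewrite (addrC (f2 x)) (addrC (f2 y)).
  have dif' x y : `|(f2 x - f1 x) - (f2 y - f1 y)| <= eucl_dist x y.
    by rewrite -normrN opprB (_ : _ - _ = (f1 x - f2 x) - (f1 y - f2 y)) //; ring.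
  have := transverse_bounded sum' dif' fq qd m.
  by have := ler_normD (f1 (q m) - f1 (q 0)) (f1 (q 0)); rewrite subrK; lra.
have nn : `|n - 0|%:~R = N :> R by rewrite subr0 ger0_norm.
have nn' : `|- n - 0|%:~R = N :> R by rewrite subr0 normrN ger0_norm.
have nN : (- n)%:~R = - N :> R by rewrite rmorphN.
set x := p n; set x' := p (- n); set y := q n; set o := p 0.
have xo : eucl_dist x o <= N + C by have := pd n 0; rewrite nn -/x -/o /C; lra.
have xo' : eucl_dist x' o <= N + C by have := pd (- n) 0; rewrite nn' -/x' -/o /C; lra.
have yo : eucl_dist y o <= N + C.
  have := qd n 0; rewrite nn; have := eucl_dist_tri y (q 0) o.
  by rewrite (eucl_dist_sym (q 0)) -/y /C -/o; lra.
have := fp n; have := fp (- n); have := fq n; have := flat_p n; have := flat_p (- n).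
have := flat_q n; rewrite nN -/N -/x -/x' -/y -/o !ler_norml.
move=> /andP[? ?] /andP[? ?] /andP[? ?] /andP[? ?] /andP[? ?] /andP[? ?].
have xy : 2 * N - C <= eucl_dist x y.
  by have := dif_lip x y; rewrite ler_norml => /andP[_]; rewrite /C -/o; lra.
have xy' : 2 * N - C <= eucl_dist x' y.
  by have := sum_lip x' y; rewrite ler_norml => /andP[]; rewrite /C -/o; lra.
have xx' : 2 * N - C <= eucl_dist x x'.
  have := sum_lip x x'; have := dif_lip x x'; rewrite !ler_norml.
  by move=> /andP[_ ?] /andP[_ ?]; rewrite /C -/o; lra.
have up z : eucl_dist z o <= N + C -> (z.1 - o.1) ^+ 2 + (z.2 - o.2) ^+ 2 <= (N + C) ^+ 2.
  by rewrite -sqr_eucl_dist ler_sqr ?nnegrE ?eucl_dist_ge0.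
have low z r : 2 * N - C <= eucl_dist z r ->
    (2 * N - C) ^+ 2 <= (z.1 - r.1) ^+ 2 + (z.2 - r.2) ^+ 2.
  by rewrite -sqr_eucl_dist ler_sqr ?nnegrE ?eucl_dist_ge0.
have := up _ xo; have := up _ xo'; have := up _ yo.
have := low _ _ xy; have := low _ _ xy'; have := low _ _ xx'.
move=> *.
have s1 := sqr_ge0 ((x.1 - o.1) + (x'.1 - o.1) + (y.1 - o.1)).
have s2 := sqr_ge0 ((x.2 - o.2) + (x'.2 - o.2) + (y.2 - o.2)).
have key : 3 * (2 * N - C) ^+ 2 <= 9 * (N + C) ^+ 2 by lra.
by lra.
Qed.

End Plane.

(** * Standard flats *)

Section Flats.
Variables (R : realType) (G : sgraph).
Local Notation X := (cpoint R G).
Variables (h : raag G) (v w : G).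
Hypothesis vw : adj v w.
Implicit Types (x y z : X) (g k : raag G) (u : G) (n m i j : int).

Lemma adj_neq : v != w.
Proof. by apply: contraTneq vw => ->; rewrite adj_irr. Qed.

Lemma clique_edge : clique [fset v; w]%fset.
Proof.
move=> a b; rewrite !in_fset2 => /orP[]/eqP-> /orP[]/eqP->; rewrite ?eqxx //.
by rewrite adj_sym.
Qed.

Definition plane_vertex g := exists i j, g = (h * zpow (gen v) i * zpow (gen w) j)%g.

Definition plane : set X :=
  [set x | (exists i j, base x = (h * zpow (gen v) i * zpow (gen w) j)%g) /\
           forall u, u != v -> u != w -> coord x u = 0].

Lemma plane_vertex_letter g u b :
  plane_vertex g -> u = v \/ u = w -> plane_vertex (g * letter (u, b))%g.
Proof.
have vwC i j := zpow_commute2 i j (genC vw).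
have lE a (c : bool) : letter (a, c) = zpow (gen a) (if c then 1 else -1).
  by case: c; rewrite ?zpow1 // letter_false zpowN zpow1.
move=> [i [j ->]] uvw; rewrite lE; set n : int := if b then 1 else -1.
case: uvw => ->.
  by exists (i + n), j; rewrite zpowD -!mulgA; congr (_ * (_ * _))%g; rewrite vwC.
by exists i, (j + n); rewrite zpowD !mulgA.
Qed.

Lemma plane_vertex_prod (Q : pred G) (r : seq G) g :
  plane_vertex g -> {in r, forall u, u = v \/ u = w} ->
  plane_vertex (g * \prod_(u <- r | Q u) gen u)%g.
Proof.
elim: r g => [|u r IH] g Hg rP; first by rewrite big_nil mulg1.
have rP' : {in r, forall u, u = v \/ u = w} by move=> a ar; apply: rP; rewrite inE ar orbT.
rewrite big_cons; case: (Q u); last exact: IH.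
rewrite mulgA; apply: IH rP'; apply: (@plane_vertex_letter _ _ true) => //.
by apply: rP; rewrite mem_head.
Qed.

Definition rho u x : R := ht u (@everywhere G) h x.

Lemma base_height_v i j :
  height v (@everywhere G) h (h * zpow (gen v) i * zpow (gen w) j)%g = i.
Proof.
have Pinv := @everywhere_invariant G v.
rewrite (height_zpow Pinv); last by left; rewrite eq_sym adj_neq.
by rewrite (height_zpow_self Pinv) // height_refl // add0r.
Qed.

Lemma base_height_w i j :
  height w (@everywhere G) h (h * zpow (gen v) i * zpow (gen w) j)%g = j.
Proof.
have Pinv := @everywhere_invariant G w.
rewrite (height_zpow_self Pinv) // (height_zpow Pinv); last by left; rewrite adj_neq.
by rewrite height_refl // add0r.
Qed.

Lemma rho_v x i j : base x = (h * zpow (gen v) i * zpow (gen w) j)%g ->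
  rho v x = i%:~R + coord x v.
Proof. by move=> xE; rewrite /rho /ht xE base_height_v asboolT. Qed.

Lemma rho_w x i j : base x = (h * zpow (gen v) i * zpow (gen w) j)%g ->
  rho w x = j%:~R + coord x w.
Proof. by move=> xE; rewrite /rho /ht xE base_height_w asboolT. Qed.

Lemma floor_int_coord (i : int) x u : Num.floor (i%:~R + coord x u) = i.
Proof.
by apply: floor_def; rewrite rmorphD /= lerDl coord_ge0 ltrD2l coord_lt1.
Qed.

Lemma plane_inj x y : plane x -> plane y -> rho v x = rho v y -> rho w x = rho w y -> x = y.
Proof.
move=> [[i [j xE]] x0] [[i' [j' yE]] y0].
rewrite (rho_v xE) (rho_v yE) (rho_w xE) (rho_w yE) => Ev Ew.
have ii : i = i' by rewrite -(floor_int_coord i x v) Ev floor_int_coord.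
have jj : j = j' by rewrite -(floor_int_coord j x w) Ew floor_int_coord.
subst i' j'; apply: cpoint_ext => [|u]; first by rewrite xE yE.
have [->|uv] := eqVneq u v; first exact: addrI Ev.
have [->|uw] := eqVneq u w; first exact: addrI Ew.
by rewrite x0 // y0.
Qed.

(** The coordinates of the point are read off from its heights, which spares computing
its base as a product over the clique. *)
Lemma plane_square m n (p : R * R) :
  m%:~R <= p.1 <= m%:~R + 1 -> n%:~R <= p.2 <= n%:~R + 1 ->
  exists x, [/\ plane x, rho v x = p.1, rho w x = p.2 &
    cube_point (h * zpow (gen v) m * zpow (gen w) n)%g [fset v; w]%fset
      (fun u => if u == v then p.1 - m%:~R else p.2 - n%:~R) x].
Proof.
move=> pm pn; set g := (h * _ * _)%g; set a := fun u => _.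
have [|x xc] := @cube_point_exists R G g _ a clique_edge.
  by move=> u; rewrite in_fset2 /a; case: eqVneq => _ _; apply/andP; split; lra.
exists x; split=> //.
- case: (xc) => _ _ bE cE; split.
    rewrite bE; apply: plane_vertex_prod; first by exists m, n.
    by move=> u; rewrite in_fset2 => /orP[]/eqP; [left|right].
  by move=> u uv uw; rewrite cE in_fset2 (negbTE uv) (negbTE uw).
- rewrite /rho (ht_cube h (@everywhere_invariant G v) xc) base_height_v.
  by rewrite in_fset2 eqxx asboolT //= /a eqxx; lra.
rewrite /rho (ht_cube h (@everywhere_invariant G w) xc) base_height_w.
by rewrite in_fset2 eqxx orbT asboolT //= /a eq_sym (negbTE adj_neq); lra.
Qed.

Lemma plane_point (p : R * R) : exists x, [/\ plane x, rho v x = p.1 & rho w x = p.2].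
Proof.
have fl (t : R) : (Num.floor t)%:~R <= t <= (Num.floor t)%:~R + 1.
  by have /andP[-> /ltW] := floor_itv t; rewrite rmorphD.
by have [x [xp xv xw _]] := plane_square (fl p.1) (fl p.2); exists x.
Qed.

Lemma square_dist m n x y :
  plane x -> plane y ->
  m%:~R <= rho v x <= m%:~R + 1 -> m%:~R <= rho v y <= m%:~R + 1 ->
  n%:~R <= rho w x <= n%:~R + 1 -> n%:~R <= rho w y <= n%:~R + 1 ->
  cat0_dist x y <= eucl_dist (rho v x, rho w x) (rho v y, rho w y).
Proof.
move=> xp yp xm ym xn yn.
have [x' [x'p xv xw xc]] := @plane_square m n (rho v x, rho w x) xm xn.
have [y' [y'p yv yw yc]] := @plane_square m n (rho v y, rho w y) ym yn.
rewrite /= in xv xw yv yw.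
rewrite (plane_inj xp x'p) // (plane_inj yp y'p) //.
apply: le_trans (cat0_cube xc yc) _.
rewrite /cube_dist (perm_big [:: v; w]) /=; last first.
  apply: uniq_perm; rewrite ?fset_uniq //= ?inE ?adj_neq // => u.
  by rewrite in_fset2 !inE.
rewrite !big_cons big_nil addr0 eqxx eq_sym (negbTE adj_neq).
rewrite xv xw yv yw le_eqVlt; apply/orP; left; apply/eqP; congr Num.sqrt => /=; ring.
Qed.

Lemma cat0_plane_le x y :
  eucl_dist (rho v x, rho w x) (rho v y, rho w y) <= cat0_dist x y.
Proof.
rewrite -ler_sqr ?nnegrE ?cat0_ge0 ?eucl_dist_ge0 // sqr_eucl_dist /=.
have := @ht_euclid R G [:: v; w] (fun=> @everywhere G) h x y.
rewrite /= inE adj_neq !big_cons big_nil addr0; exact.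
Qed.

(** Both exponents together do not increase distances, which bounds the CAT(0) distance
from below; a segment cut at the lines of the integral grid bounds it from above. *)
Lemma plane_flat : exists e : R * R -> X,
  [/\ forall p q, cat0_dist (e p) (e q) = eucl_dist p q,
      forall p, [/\ plane (e p), rho v (e p) = p.1 & rho w (e p) = p.2] &
      forall x, plane x -> e (rho v x, rho w x) = x].
Proof.
have [e eP] := choice plane_point.
have eE p : (rho v (e p), rho w (e p)) = p by case: (eP p) => _ -> ->; case: p.
exists e; split=> // [p q|x xp]; last first.
  by have [? ? ?] := eP (rho v x, rho w x); exact: plane_inj.
apply/eqP; rewrite eq_le; apply/andP; split; last first.
  by rewrite -{1}[p]eE -{1}[q]eE cat0_plane_le.
move: p q; apply: (@grid_cut R (fun p q => cat0_dist (e p) (e q))).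
- by move=> p q; exact: cat0_sym.
- by move=> p q r; exact: cat0_tri.
move=> m n p q pm qm pn qn; rewrite -{2}[p]eE -{2}[q]eE.
have [ep pv pw] := eP p; have [eq qv qw] := eP q.
by apply: (@square_dist m n) => //; rewrite ?pv ?pw ?qv ?qw.
Qed.

Lemma plane_is_flat : is_flat plane.
Proof.
have [e [ed eP eK]] := plane_flat; exists e; split=> //.
apply/seteqP; split=> [x xp|_ [p _ <-]]; last by case: (eP p).
by exists (rho v x, rho w x) => //; exact: eK.
Qed.

Lemma plane_standard : standard_flat plane.
Proof.
split; first exact: plane_is_flat.
exists h, v, w; split=> //; apply/seteqP; split=> g.
  by rewrite (gen_coset2P _ _ vw) => -[].
by rewrite (gen_coset2P _ _ vw) => gE; split=> // u _ _; exact: fsfun0E.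
Qed.

Lemma ht_plane u P x : star_invariant u P -> u != v -> u != w -> plane x -> ht u P h x = 0.
Proof.
move=> Pinv uv uw [[i [j xE]] x0]; rewrite /ht x0 // if_same addr0 xE.
rewrite (height_zpow Pinv); last by left; rewrite eq_sym.
rewrite (height_zpow Pinv); last by left; rewrite eq_sym.
by rewrite height_refl.
Qed.

Lemma height_plane u P f (y : raag G) : star_invariant u P -> u != v -> u != w -> plane_vertex f ->
  height u P h y = height u P f y.
Proof.
move=> Pinv uv uw [i [j fE]].
have [W WE] := of_word_surj (f^-1 * y)%g.
have -> : y = (f * of_word W)%g by rewrite WE mulVKg.
rewrite (height_word Pinv).
have [V VE] := of_word_surj (h^-1 * f)%g.
have fV : f = (h * of_word V)%g by rewrite VE mulVKg.
rewrite {1}fV -mulgA -of_word_mul (height_word Pinv) rise_cat -fV.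
rewrite -(height_word Pinv) -fV fE.
rewrite (height_zpow Pinv); last by left; rewrite eq_sym.
rewrite (height_zpow Pinv); last by left; rewrite eq_sym.
by rewrite height_refl // add0r.
Qed.

Lemma commute_letter u b (g : raag G) : commute (gen u) g -> commute (letter (u, b)) g.
Proof.
by case: b => // ug; rewrite letter_false; apply/commute_sym/commuteV/commute_sym.
Qed.

(** A point off the plane is separated from it by a hyperplane next to the plane: take
a shortest word from the plane to the point; its first letter crosses a hyperplane
that the rest of the word cannot cross back, since cancelling the two crossings would
give a shorter word. *)
Lemma separate_plane z : ~ plane z -> exists u P,
  [/\ star_invariant u P, u != v, u != w & ht u P h z != 0].
Proof.
move=> zp.
have minH : exists n : nat, `[< exists2 f, plane_vertex f & word_dist f (base z) = n >].
  exists (word_dist h (base z)); apply/asboolP; exists h => //.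
  by exists 0, 0; rewrite !zpow0 !mulg1.
case: (ex_minnP minH) => n /asboolP[f Hf fn] nmin {minH}.
have [W WE WS] := word_lengthP (f^-1 * base z)%g.
have zE : base z = (f * of_word W)%g by rewrite WE mulVKg.
have {}WS : size W = n by rewrite WS.
have short f' W' : plane_vertex f' -> base z = (f' * of_word W')%g -> (n <= size W')%N.
  move=> Hf' zE'; apply: leq_trans (word_length_le W'); apply: nmin.
  by apply/asboolP; exists f' => //; rewrite /word_dist zE' mulKg.
case: W WE WS zE => [|[u b] W] WE WS zE.
  have Hz : plane_vertex (base z) by rewrite zE of_word_nil mulg1.
  have [u [uv uw u0]] : exists u, [/\ u != v, u != w & coord z u != 0].
    apply: contrapT => none; apply: zp; split=> // u uv uw.
    by apply: contrapT => /eqP u0; apply: none; exists u.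
  exists u, (@everywhere G); split=> //.
  have Pinv := @everywhere_invariant G u.
  by rewrite /ht (height_plane _ Pinv uv uw Hz) height_refl // add0r asboolT.
have uvw : ~ (u = v \/ u = w).
  move=> uvw; have := short (f * letter (u, b))%g W (plane_vertex_letter b Hf uvw).
  by rewrite zE of_word_cons mulgA => /(_ erefl); rewrite -WS /= ltnn.
have uv : u != v by apply/eqP => E; apply: uvw; left.
have uw : u != w by apply/eqP => E; apply: uvw; right.
pose P := star_coset u f; have Pinv : star_invariant u P := star_coset_invariant f.
pose s : int := if b then 1 else -1.
have no_return A c B : W = A ++ (u, c) :: B ->
    P (f * letter (u, b) * of_word A)%g -> c = b.
  move=> WAB [T /star_word_commute uT]; rewrite -mulgA => /mulgI AT.
  case: (eqVneq c b) => // cb; have {}cb : c = ~~ b by move: cb; case: (c); case: (b).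
  have lE : commute (letter (u, b)) (of_word A).
    apply: commute_letter; rewrite -[of_word A](mulKg (letter (u, b))) AT.
    apply: commuteM uT; apply/commuteV/commute_sym/commute_letter.
    exact: commute_refl.
  have : (n <= size (A ++ B))%N.
    apply: (short f) => //; rewrite zE WAB cb of_word_cons !of_word_mul of_word_cons.
    rewrite letter_neg; congr (_ * _)%g.
    by rewrite !mulgA; congr (_ * _)%g; rewrite lE mulgK.
  by rewrite -WS WAB /= !size_cat /=; lia.
have pos V (y : raag G) : (forall A c B, V = A ++ (u, c) :: B -> P (y * of_word A)%g -> c = b) ->
    0 <= s * rise u P y V.
  elim: V y => [|[c d] V IH] y VP; first by rewrite /= mulr0.
  rewrite /= mulrDr addr_ge0 //; last first.
    apply: IH => A e B VE; rewrite -mulgA -of_word_cons.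
    by apply: (VP ((c, d) :: A) e B); rewrite VE.
  rewrite /step /=; case: eqVneq => [cu|_] /=; last by rewrite mulr0.
  case: asboolP => Py; last by rewrite mulr0.
  have -> : d = b by apply: (VP [::] d V); rewrite ?cu // mulg1.
  by rewrite /s; case: (b).
have hz : 1 <= s * height u P h (base z).
  rewrite (height_plane _ Pinv uv uw Hf) zE (height_word Pinv) /= mulrDr.
  have -> : s * step u P f (u, b) = 1.
    by rewrite /step eqxx asboolT /=; [rewrite /s; case: (b)|exact: star_coset_refl].
  by rewrite lerDl; apply: pos.
exists u, P; split=> //; rewrite /ht.
have c0 := coord_ge0 z u; have c1 := coord_lt1 z u.
have [c [ci0 ci1 ->]] : exists c : R, [/\ 0 <= c, c < 1 &
    (if `[< P (base z) >] then coord z u else 0) = c].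
  by case: asboolP => _; [exists (coord z u) | exists 0; rewrite ltr01].
move: hz; rewrite /s; case: (b) => [|].
  by rewrite mul1r -(ler_int R) => h1; rewrite gt_eqF //; lra.
rewrite mulN1r lerNr -(ler_int R) rmorphN => h1; rewrite lt_eqF //.
by move: h1 => /= h1; lra.
Qed.

(** Together with the two exponents, the height of a separating hyperplane is a third
orthogonal coordinate; it makes a detour through a point off the plane strictly longer
than the straight segment. *)
Lemma plane_convex : cat0_convex plane.
Proof.
move=> x y z xp yp xzy; apply: contrapT => /separate_plane[u [P [Pinv uv uw zu]]].
have [e [ed eP eK]] := plane_flat.
have dxy : cat0_dist x y ^+ 2 = (rho v x - rho v y) ^+ 2 + (rho w x - rho w y) ^+ 2.
  by rewrite -{1}(eK x) // -{1}(eK y) // ed sqr_eucl_dist.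
have d3 x' : plane x' -> (rho v x' - rho v z) ^+ 2 + (rho w x' - rho w z) ^+ 2 +
    ht u P h z ^+ 2 <= cat0_dist x' z ^+ 2.
  move=> x'p; pose Q a := if a == u then P else @everywhere G.
  have := @ht_euclid R G [:: v; w; u] Q h x' z; rewrite /= !inE negb_or adj_neq.
  rewrite ![_ == u]eq_sym uv uw !big_cons big_nil addr0 /Q.
  rewrite ![_ == u]eq_sym (negbTE uv) (negbTE uw) eqxx (ht_plane Pinv uv uw x'p) sub0r sqrrN.
  rewrite addrA; apply=> // a _; case: eqVneq => [->//|_]; exact: everywhere_invariant.
have := d3 x xp; have := d3 y yp; move: xzy dxy; rewrite (cat0_sym z y).
have := cat0_ge0 x z; have := cat0_ge0 y z.
have : 0 < ht u P h z ^+ 2 by rewrite exprn_even_gt0.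
move: (cat0_dist x z) (cat0_dist y z) (cat0_dist x y) (ht u P h z ^+ 2).
move: (rho v x) (rho v y) (rho v z) (rho w x) (rho w y) (rho w z).
move=> x1 y1 z1 x2 y2 z2 d1 d2 d c c0 d20 d10 <- dE hy hx.
pose A1 := x1 - z1; pose A2 := x2 - z2; pose B1 := z1 - y1; pose B2 := z2 - y2.
have AB : A1 * B1 + A2 * B2 <= d1 * d2.
  apply: dot_le => //; first by rewrite /A1 /A2; lra.
  by rewrite /B1 /B2 -(sqrrN (z1 - y1)) opprB -(sqrrN (z2 - y2)) opprB; lra.
by rewrite /A1 /A2 /B1 /B2 in AB; nra.
Qed.

(** Every point of the plane is the midpoint of two points on the axes, so a convex set
that contains the axes contains the plane. *)
Lemma plane_span : span_flat (sline h v : set X) (sline h w).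
Proof.
rewrite /span_flat.
suff -> : smallest (@cat0_convex R G) (sline h v `|` sline h w) = plane.
  exact: plane_is_flat.
have H0 : forall x, plane x -> rho w x = 0 -> sline h v x.
  move=> x [[i [j xE]] x0]; rewrite (rho_w xE) => jc.
  have j0 : j = 0 by rewrite -(floor_int_coord j x w) jc floor0.
  have c0 : coord x w = 0 by move: jc; rewrite j0 add0r.
  split; first by exists i; rewrite xE j0 zpow0 mulg1.
  by move=> u uv; have [->//|uw] := eqVneq u w; exact: x0.
have H1 : forall x, plane x -> rho v x = 0 -> sline h w x.
  move=> x [[i [j xE]] x0]; rewrite (rho_v xE) => ic.
  have i0 : i = 0 by rewrite -(floor_int_coord i x v) ic floor0.
  have c0 : coord x v = 0 by move: ic; rewrite i0 add0r.
  split; first by exists j; rewrite xE i0 zpow0 mulg1.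
  by move=> u uw; have [->//|uv] := eqVneq u v; exact: x0.
apply/seteqP; split=> [x|x xp].
  apply; split; first exact: plane_convex.
  move=> y [] [[n yE] y0]; split.
  - by exists n, 0; rewrite zpow0 mulg1.
  - by move=> u uv _; exact: y0.
  - by exists 0, n; rewrite zpow0 mulg1.
  - by move=> u _ uw; exact: y0.
move=> C [Cconv CS]; have [e [ed eP eK]] := plane_flat.
pose a := e (2 * rho v x, 0); pose b := e (0, 2 * rho w x).
apply: (Cconv a b).
- by apply: CS; left; apply: H0; case: (eP (2 * rho v x, 0)).
- by apply: CS; right; apply: H1; case: (eP (0, 2 * rho w x)).
rewrite -(eK x xp) !ed -(@eucl_segment _ (2 * rho v x, 0) (0, 2 * rho w x) 2^-1); last first.
  by apply/andP; split; lra.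
have -> : segment_point (2 * rho v x, 0) (0, 2 * rho w x) 2^-1 = (rho v x, rho w x).
  by rewrite /segment_point /=; congr (_, _); field.
by [].
Qed.

End Flats.

(** * Adjacency in the extension graph *)

Section Adjacency.
Variables (R : realType) (G : sgraph).
Local Notation X := (cpoint R G).
Implicit Types (x y z : X) (g h k : raag G) (a b u v w : G) (n m i j : int).

Lemma sline_inj h a x y : sline h a x -> sline h a y ->
  ht a (@everywhere G) h x = ht a (@everywhere G) h y -> x = y.
Proof.
move=> [[n xE] x0] [[m yE] y0]; have Pinv := @everywhere_invariant G a.
rewrite (ht_sline Pinv _ xE) // (ht_sline Pinv _ yE) // => E.
have nm : n = m by rewrite -(floor_int_coord n x a) E floor_int_coord.
subst m; apply: cpoint_ext => [|u]; first by rewrite xE yE.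
have [->|ua] := eqVneq u a; first exact: addrI E.
by rewrite x0 // y0.
Qed.

Lemma sline_cell h a n (t : R) : n%:~R <= t <= n%:~R + 1 -> exists x,
  [/\ sline h a x, ht a (@everywhere G) h x = t &
    cube_point (h * zpow (gen a) n)%g [fset a]%fset (fun=> t - n%:~R) x].
Proof.
move=> tn; set g := (h * _)%g; have Pinv := @everywhere_invariant G a.
have [|x xc] := @cube_point_exists R G g _ (fun=> t - n%:~R) (@clique1 _ a).
  by move=> _ _; apply/andP; split; lra.
exists x; split=> //.
  have /cube_point1[_ bE _ x0] := xc; split=> //; rewrite bE.
  by case: ifP => _; [exists (n + 1); rewrite zpowS mulgA | exists n].
rewrite (ht_cube h Pinv xc) in_fset1 eqxx asboolT //=.
by rewrite (height_zpow_self Pinv) // height_refl // add0r; lra.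
Qed.

Lemma sline_isometry h a : exists f : R -> X,
  [/\ forall t, sline h a (f t), forall s t, cat0_dist (f s) (f t) = `|s - t| &
      forall n, f n%:~R = vertex R (h * zpow (gen a) n)%g].
Proof.
have Pinv := @everywhere_invariant G a.
have pt (t : R) : exists x, sline h a x /\ ht a (@everywhere G) h x = t.
  have tn : (Num.floor t)%:~R <= t <= (Num.floor t)%:~R + 1.
    by have /andP[-> /ltW] := floor_itv t; rewrite rmorphD.
  by have [x [? ? _]] := sline_cell h a tn; exists x.
have [f fP] := choice pt; exists f; split=> [t|s t|n].
- by case: (fP t).
- apply/eqP; rewrite eq_le; apply/andP; split; last first.
    have [_ {1}<-] := fP s; have [_ {1}<-] := fP t; exact: ht_lipschitz.
  have -> : `|s - t| = eucl_dist (s, 0) (t, 0).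
    by rewrite /eucl_dist /= subrr expr0n addr0 sqrtr_sqr.
  pose D (p q : R * R) := cat0_dist (f p.1) (f q.1).
  rewrite -[cat0_dist _ _]/(D (s, 0) (t, 0)).
  apply: (@slab_cut R D (fun p => p.2 = 0) fst) => //.
  + by move=> p q; exact: cat0_sym.
  + by move=> p q r; exact: cat0_tri.
  + by move=> p q r /= -> -> _; rewrite subrr mulr0 addr0.
  move=> m p q p0 q0 pm qm; rewrite /D.
  have [x [xl xt xc]] := sline_cell h a pm; have [y [yl yt yc]] := sline_cell h a qm.
  have [pl pt'] := fP p.1; have [ql qt'] := fP q.1.
  rewrite (sline_inj pl xl) ?pt' // (sline_inj ql yl) ?qt' //.
  apply: le_trans (cat0_cube xc yc) _; rewrite cube_dist1 /eucl_dist p0 q0.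
  by rewrite subrr expr0n addr0 sqrtr_sqr opprB addrA subrK.
have [fl ft] := fP n%:~R; apply: (sline_inj fl); first exact: sline_zpow.
by rewrite ft ht_zpow.
Qed.

(** In the coordinates of the flat, the geodesic is an isometrically embedded line of the
Euclidean plane, hence affine. *)
Lemma sline_in_flat h a (e : R * R -> X) :
  (forall p q, cat0_dist (e p) (e q) = eucl_dist p q) -> sline h a `<=` range e ->
  exists u c : R * R, u.1 ^+ 2 + u.2 ^+ 2 = 1 /\
    exists f : R -> X, [/\ forall t, f t = e (c.1 + t * u.1, c.2 + t * u.2),
      forall t, sline h a (f t) &
      forall n, f n%:~R = vertex R (h * zpow (gen a) n)%g].
Proof.
move=> ed le; have [f [fl fd fz]] := sline_isometry h a.
have /choice[r rP] : forall t, exists p, e p = f t.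
  by move=> t; have [p _ <-] := le _ (fl t); exists p.
have [|u [u1 uE]] := @line_affine _ r; first by move=> s t; rewrite -ed !rP.
by exists u, (r 0); split=> //; exists f; split=> // t; rewrite -uE rP.
Qed.

(** If the labels are not adjacent, the sum and the difference of their exponents are
Lipschitz, so both halves of the first line make an angle pi with the same half of the
second one at their crossing; this is impossible in the plane. *)
Lemma adj_of_flat k v w (e : R * R -> X) : v != w ->
  (forall p q, cat0_dist (e p) (e q) = eucl_dist p q) ->
  sline k v `<=` range e -> sline k w `<=` range e -> adj v w.
Proof.
move=> vw ed le le'; apply: contraT => not_adj.
have [u [c [u1 [f [fE _ fz]]]]] := sline_in_flat ed le.
have [u' [c' [u1' [f' [fE' _ fz']]]]] := sline_in_flat ed le'.
have e_inj p q : e p = e q -> p = q.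
  move=> pq; have := ed p q; rewrite pq; have /eqP := ed q q.
  rewrite /eucl_dist !subrr expr0n addr0 sqrtr0 => /eqP-> /esym/eqP.
  rewrite sqrtr_eq0 => le0; have {le0} : (p.1 - q.1) ^+ 2 + (p.2 - q.2) ^+ 2 = 0.
    by apply/eqP; rewrite eq_le le0 addr_ge0 ?sqr_ge0.
  move/eqP; rewrite paddr_eq0 ?sqr_ge0 // !sqrf_eq0 !subr_eq0 => /andP[/eqP p1 /eqP p2].
  by case: p q p1 p2 {pq} => [? ?] [? ?] /= -> ->.
have cc : c = c'.
  have := fz 0; have := fz' 0; rewrite !zpow0 => <-.
  rewrite fE fE' => /e_inj [] /=; rewrite !mul0r !addr0.
  by case: c {fE} => ? ?; case: c' {fE'} => ? ? /= -> ->.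
have Pv := @everywhere_invariant G v; have Pw := @everywhere_invariant G w.
have cross g (s : {fset G}) : clique s ->
    ~~ (cube_slope v (@everywhere G) g s && cube_slope w (@everywhere G) g s).
  move=> cs; apply: contra not_adj => /andP[/andP[vs _] /andP[ws _]].
  exact: cs.
have far (s : int) : `|s| = 1 ->
    2 <= cat0_dist (vertex R (k * zpow (gen v) s)%g) (vertex R (k * zpow (gen w) 1)%g).
  move=> s1; have s1' : `|s%:~R| = 1 :> R by rewrite -intr_norm s1.
  have := @ht_pm_lipschitz R G v w (@everywhere G) (@everywhere G) k k s%:~R (-1)
    (vertex R (k * zpow (gen v) s)%g) (vertex R (k * zpow (gen w) 1)%g) Pv Pw.
  rewrite !ht_zpow // (ht_sline_const k (k := k) (b := w) Pv); last 2 first.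
  - by left; rewrite eq_sym.
  - exact: sline_zpow.
  rewrite (ht_sline_const k (k := k) (b := v) Pw); last 2 first.
  - by left.
  - exact: sline_zpow.
  rewrite !height_refl // s1' normrN1 lexx !mulr0 addr0 add0r mulr1 opprK.
  rewrite -expr2 -[s%:~R ^+ 2]real_normK ?num_real // s1' expr1n => h2.
  have := h2 isT isT cross; rewrite ger0_norm //; exact: addr_ge0.
have := far 1 (normr1 _); have := far (-1) (normrN1 _).
rewrite -!fz -fz' !fE fE' !ed cc.
rewrite -[2 <= _]ler_sqr ?nnegrE ?eucl_dist_ge0 // sqr_eucl_dist /= => far1.
rewrite -[2 <= _]ler_sqr ?nnegrE ?eucl_dist_ge0 // sqr_eucl_dist /= => far2.
move: far1 far2; rewrite rmorphN /= => far1 far2.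
by nra.
Qed.

(** Nonparallel affine lines of the flat cross, and the base of the crossing point is a
vertex of both geodesics. *)
Lemma ext_adj_standard (c c' : ext_graph R G) : adj c c' ->
  exists k v w, [/\ adj v w, represents (sline k v) c & represents (sline k w) c'].
Proof.
move=> /andP[cc' /asboolP[l [l' [lc lc' [e [ed FE]]]]]].
have le : l `<=` range e by rewrite -FE => x lx C [_]; apply; left.
have le' : l' `<=` range e by rewrite -FE => x lx C [_]; apply; right.
have [g [v lE]] := represents_standard lc; have [h [w lE']] := represents_standard lc'.
subst l l'.
have not_par : ~ parallel (sline g v : set X) (sline h w).
  by move=> p; move/eqP: cc'; apply; exact: represents_eq lc lc' p.
have [u [p [u1 [f [fE fl fz]]]]] := sline_in_flat ed le.
have [u' [p' [u1' [f' [fE' fl' fz']]]]] := sline_in_flat ed le'.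
have : exists2 x : X, sline g v x & sline h w x.
  pose det := u.1 * u'.2 - u.2 * u'.1.
  have [d0|d0] := eqVneq det 0; last first.
    pose t := ((p'.1 - p.1) * u'.2 - (p'.2 - p.2) * u'.1) / det.
    pose s := ((p'.1 - p.1) * u.2 - (p'.2 - p.2) * u.1) / det.
    exists (f t) => //; have -> : f t = f' s; last exact: fl'.
    by rewrite fE fE' /t /s /det; congr (e (_, _)); field.
  case: not_par; apply/parallelP; apply: (@sline_near R _ _ _ _ _ (eucl_dist p p')) => n.
  pose c0 := u.1 * u'.1 + u.2 * u'.2.
  have E1 : c0 * u'.1 = u.1.
    have : u.1 * (u'.1 ^+ 2 + u'.2 ^+ 2) = u.1 by rewrite u1' mulr1.
    by rewrite /c0; move: d0; rewrite /det => /eqP; rewrite subr_eq0 => /eqP d0;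
      have := congr1 (fun t => t * u'.2) d0 => /= d1; lra.
  have E2 : c0 * u'.2 = u.2.
    have : u.2 * (u'.1 ^+ 2 + u'.2 ^+ 2) = u.2 by rewrite u1' mulr1.
    by rewrite /c0; move: d0; rewrite /det => /eqP; rewrite subr_eq0 => /eqP d0;
      have := congr1 (fun t => t * u'.1) d0 => /= d1; lra.
  exists (f' (n%:~R * c0)) => //; rewrite -fz fE fE' ed -!mulrA E1 E2.
  by rewrite le_eqVlt; apply/orP; left; apply/eqP; congr Num.sqrt => /=; ring.
case=> x [[n xE] _] [[m xE'] _].
rewrite -(sline_shift _ g v n) -xE in le lc not_par.
rewrite -(sline_shift _ h w m) -xE' in le' lc' not_par.
exists (base x), v, w; split=> //; apply: adj_of_flat ed le le'.
by apply/eqP => vw; apply: not_par; rewrite vw; exact: parallel_refl.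
Qed.

Lemma ext_adj_intro k v w (c c' : ext_graph R G) : adj v w -> c != c' ->
  represents (sline k v) c -> represents (sline k w) c' -> adj c c'.
Proof.
move=> vw cc' kc kc'; apply/andP; split=> //; apply/asboolP.
by exists (sline k v), (sline k w); split=> //; exact: plane_span.
Qed.

(** * Crossing families of parallel geodesics *)

Section Crossing.
Variables (h1 h2 : raag G) (a b : G).
Hypothesis not_par : ~ (a = b /\ star_coset a h1 h2).
Hypothesis no_cross : ~ exists k, [/\ star_coset a h1 k, star_coset b h2 k & adj a b].

Lemma cross_eq g : star_coset a h1 g -> star_coset b h2 g -> ~ star a b.
Proof.
move=> ag bg /orP[/eqP ba|ab]; last by apply: no_cross; exists g.
apply: not_par; split=> //; apply: star_coset_trans ag _.
by apply: star_coset_sym; rewrite -{1}ba.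
Qed.

(** A flat cannot stay close to two such geodesics: the sum and the difference of
their heights would both be Lipschitz. *)
Lemma flat_crossing (e : R * R -> X) (E F : R) :
  (forall p q, cat0_dist (e p) (e q) = eucl_dist p q) ->
  (forall n, exists p, cat0_dist (vertex R (h1 * zpow (gen a) n)%g) (e p) <= E) ->
  (forall n, exists p, cat0_dist (vertex R (h2 * zpow (gen b) n)%g) (e p) <= F) ->
  False.
Proof.
move=> ed /choice[p pE] /choice[q qF].
have E0 : 0 <= E by apply: le_trans (pE 0); exact: cat0_ge0.
have F0 : 0 <= F by apply: le_trans (qF 0); exact: cat0_ge0.
have Pinv := @star_coset_invariant _ a h1; have Qinv := @star_coset_invariant _ b h2.
pose f1 r := ht a (star_coset a h1) h1 (e r).
pose f2 r := ht b (star_coset b h2) h2 (e r).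
have slopes g s : clique s ->
    ~~ (cube_slope a (star_coset a h1) g s && cube_slope b (star_coset b h2) g s).
  move=> cs; apply/negP => /andP[/andP[as_ /asboolP ag] /andP[bs /asboolP bg]].
  exact: cross_eq ag bg (clique_star cs as_ bs).
have pm (d : R) r s : `|d| <= 1 -> `|(f1 r + d * f2 r) - (f1 s + d * f2 s)| <= eucl_dist r s.
  move=> d1; have n1 : `|1| <= 1 :> R by rewrite normr1.
  by have := ht_pm_lipschitz h1 h2 (e r) (e s) Pinv Qinv n1 d1 slopes; rewrite !mul1r ed.
have dist g c n m r s (D : R) : 0 <= D -> cat0_dist (vertex R (g * zpow (gen c) n)%g) (e r) <= D ->
    cat0_dist (vertex R (g * zpow (gen c) m)%g) (e s) <= D ->
    eucl_dist r s <= `|n - m|%:~R + 2 * D.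
  move=> D0 rD sD; rewrite -ed.
  have := cat0_tri (e r) (vertex R (g * zpow (gen c) n)%g) (e s).
  have := cat0_tri (vertex R (g * zpow (gen c) n)%g) (vertex R (g * zpow (gen c) m)%g) (e s).
  have := @cat0_vertex R _ (g * zpow (gen c) n)%g (g * zpow (gen c) m)%g.
  by rewrite word_dist_zpow // (cat0_sym (e r) (vertex _ _)) natr_absz; lra.
apply: (@plane_contradiction R f1 f2 (E + F) p q).
- by move=> r s; have := pm 1 r s; rewrite !mul1r normr1 lexx; apply.
- by move=> r s; have := pm (-1) r s; rewrite !mulN1r normrN1 lexx; apply.
- move=> n; rewrite distrC -(ht_zpow R n Pinv (star_coset_refl a h1)).
  by apply: le_trans (ht_lipschitz _ _ _ Pinv) _; apply: le_trans (pE n) _; lra.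
- move=> n; rewrite distrC -(ht_zpow R n Qinv (star_coset_refl b h2)).
  by apply: le_trans (ht_lipschitz _ _ _ Qinv) _; apply: le_trans (qF n) _; lra.
- by move=> n m; have := dist h1 a n m (p n) (p m) E E0 (pE n) (pE m); lra.
by move=> n m; have := dist h2 b n m (q n) (q m) F F0 (qF n) (qF m); lra.
Qed.

(** An [a]-edge in the star coset of [b] at which the height changes would be parallel to
both geodesics or a side of a square formed by parallels of both. *)
Lemma height_crossing g : star_coset b h2 g ->
  height a (star_coset a h1) h1 g = height a (star_coset a h1) h1 h2.
Proof.
have Pinv := @star_coset_invariant _ a h1.
move=> [W bW ->]; have := star_coset_refl b h2; move: {2 3 4}h2 => y.
elim: W y bW => [|[c d] W IH] y; first by rewrite of_word_nil mulg1.
move=> /= /andP[bc bW] by_; rewrite of_word_cons mulgA IH //; last first.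
  by apply: star_coset_trans by_ _; exact: star_coset_letter.
rewrite (height_letter Pinv) /step /=; case: eqVneq => [ca|_] /=; last exact: addr0.
case: asboolP => ya; last exact: addr0.
by case: (cross_eq ya by_); rewrite star_sym -ca.
Qed.

End Crossing.
End Adjacency.

(** * The induced map preserves adjacency *)

Section Preserve.
Variables (R : realType) (G L : sgraph) (phi : raag G -> raag L).
Hypothesis hphi : qi_embedding R phi.
Variable f : ext_graph R G -> ext_graph R L.
Hypothesis f_ind : induces phi f.

(** It suffices to exclude that the two image geodesics have no crossing parallels. *)
Lemma adj_of_crossing :
  (forall k v w h1 h2 a b, adj v w ->
     finite_hausdorff (@wdist R L) (phi @` gen_coset k [set gen v])
       (gen_coset h1 [set gen a]) ->
     finite_hausdorff (@wdist R L) (phi @` gen_coset k [set gen w])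
       (gen_coset h2 [set gen b]) ->
     (forall c, represents (sline k w) c -> represents (sline h2 b) (f c)) ->
     ~ (a = b /\ star_coset a h1 h2) ->
     ~ (exists k, [/\ star_coset a h1 k, star_coset b h2 k & adj a b]) -> False) ->
  forall c c', adj c c' -> adj (f c) (f c').
Proof.
move=> excl c c' cc'; have ff : f c != f c'.
  apply: contraTneq cc' => /(induces_injective hphi f_ind)->.
  by rewrite adj_irr.
have [k [v [w [vw kc kc']]]] := ext_adj_standard cc'.
have [l lc hl] := f_ind kc; have [l' lc' hl'] := f_ind kc'.
have [h1 [a lE]] := represents_standard lc; have [h2 [b lE']] := represents_standard lc'.
subst l l'; rewrite !vertex_set_sline in hl hl'.
apply: contrapT => /negP not_adj; apply: (excl k v w h1 h2 a b) => //.
- by move=> d kd; rewrite -(represents_eq kc' kd (parallel_refl _)).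
- move=> /(parallelP R) par; move/eqP: ff; apply.
  exact: (represents_eq lc lc' par).
move=> [g [ag bg ab]]; move/negP: not_adj; apply; apply: (ext_adj_intro (k := g) ab ff).
  by apply: represents_trans lc _; apply/parallelP; split.
by apply: represents_trans lc' _; apply/parallelP; split.
Qed.

(** The flat near the image of the standard flat is close to both image geodesics. *)
Lemma adj_of_flats :
  (forall F : set (cpoint R G), standard_flat F ->
     exists2 F' : set (cpoint R L), is_flat F' &
       finite_hausdorff cat0_dist (complex_map phi @` F) F') ->
  forall c c', adj c c' -> adj (f c) (f c').
Proof.
move=> flats; apply: adj_of_crossing => k v w h1 h2 a b vw [D1 [_ hD1]] [D2 [_ hD2]] _.
move=> not_par no_cross.
have [F' [e [ed ->]] [D [FD _]]] := flats _ (plane_standard R k vw).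
have near g h u D' : (forall g0, gen_coset k [set gen u] g0 ->
      plane k v w (vertex R g0)) ->
    (forall y, gen_coset h [set gen g] y ->
       exists2 x, (phi @` gen_coset k [set gen u]) x & wdist R x y <= D') ->
    forall n, exists p, cat0_dist (vertex R (h * zpow (gen g) n)%g) (e p) <= D' + D.
  move=> sub hD n; have [|_ [g0 g0k <-] g0n] := hD (h * zpow (gen g) n)%g.
    by apply/gen_cosetP; exists n.
  have [|_ [p _ <-] g0p] := FD (vertex R (phi g0)).
    by exists (vertex R g0) => //; exact: sub.
  exists p; apply: le_trans (cat0_tri _ (vertex R (phi g0)) _) (lerD _ g0p).
  by rewrite cat0_sym; apply: le_trans (cat0_vertex _ _ _) g0n.
apply: (flat_crossing not_par no_cross ed (near _ _ _ _ _ hD1) (near _ _ _ _ _ hD2)).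
  move=> _ /gen_cosetP[n ->]; split; last by move=> u _ _; exact: fsfun0E.
  by exists n, 0; rewrite zpow0 mulg1.
move=> _ /gen_cosetP[n ->]; split; last by move=> u _ _; exact: fsfun0E.
by exists 0, n; rewrite zpow0 mulg1.
Qed.

(** The constant of stability is uniform over the parallels of the second geodesic that
pass through the points of the first one; this replaces the flat. *)
Lemma adj_of_stable : stable R phi -> forall c c', adj c c' -> adj (f c) (f c').
Proof.
move=> [D stab]; apply: adj_of_crossing => k v w h1 h2 a b vw [D1 [_ hD1]] _ f_w.
move=> not_par no_cross.
have Pinv := @star_coset_invariant _ a h1.
pose t : raag L -> R := fun y => (height a (star_coset a h1) h1 y)%:~R.
have t_lip y z : `|t y - t z| <= wdist R y z.
  rewrite /t -(ht_vertex R _ _ h1 y) -(ht_vertex R _ _ h1 z).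
  exact: le_trans (ht_lipschitz _ _ _ Pinv) (cat0_vertex _ _ _).
(* Each point of the first geodesic lies on a parallel of the second one, whose image
   is close to a geodesic along which [t] is constant. *)
have t_bound n : `|t (phi (k * zpow (gen v) n)%g) - t h2| <= D.
  pose g := (k * zpow (gen v) n)%g.
  have kg : star_coset w k g.
    by apply: star_coset_zpow; rewrite /star adj_sym vw orbT.
  have [c gc] := class_exists R g w.
  have kc : represents (sline k w) c.
    by apply: represents_trans gc _; apply/parallel_sym/parallelP; split.
  have [l' /standard_geodesicP[h' [b' ->]] hl'] := stab _ (sline_standard R g w).
  have [m mc hm] := f_ind gc; have [h'' [b'' mE]] := represents_standard mc; subst m.
  rewrite !vertex_set_sline in hl' hm.
  have par : parallel (sline h2 b : set (cpoint R L)) (sline h' b').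
    apply: parallel_trans (represents_parallel (f_w _ kc) mc) _.
    apply: parallel_of_vertices; apply: (finite_hausdorff_trans (@wdist_tri R L)).
      exact: (finite_hausdorff_sym (@wdist_sym R L) hm).
    by exists D.
  have /parallelP[bb h2h'] := par; subst b'.
  have [|y /gen_cosetP[j yE] gy] := hl'.1 (phi g).
    by exists g => //; apply/gen_cosetP; exists 0; rewrite zpow0 mulg1.
  have -> : t h2 = t y.
    rewrite /t (height_crossing not_par no_cross (_ : star_coset b h2 y)) // yE.
    apply: star_coset_trans h2h' _; apply: star_coset_zpow; exact: star_refl.
  exact: le_trans (t_lip _ _) gy.
pose n : int := Num.floor (D + D1 + t h2) + 1.
have [|_ [_ /gen_cosetP[m ->] <-] mn] := hD1 (h1 * zpow (gen a) n)%g.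
  by apply/gen_cosetP; exists n.
have tn : t (h1 * zpow (gen a) n)%g = n%:~R.
  rewrite /t (height_zpow_self Pinv) ?height_refl // ?add0r //.
  exact: star_coset_refl.
clear not_par no_cross.
have := le_trans (t_lip _ _) mn; have := t_bound m; rewrite tn !ler_norml.
have := floorD1_gt (D + D1 + t h2); rewrite -/n.
by move=> ? /andP[? ?] /andP[? ?]; lra.
Qed.

End Preserve.

Theorem proposition6p2 (R : realType) (G L : sgraph) (phi : raag G -> raag L)
    (hG : finite_clique_number G) (hL : finite_clique_number L)
    (hphi : qi_embedding R phi) :
  (weakly_stable R phi ->
   (forall F : set (cpoint R G), standard_flat F ->
      exists2 F' : set (cpoint R L), is_flat F' &
        finite_hausdorff cat0_dist (complex_map phi @` F) F') ->
   exists2 f : ext_graph R G -> ext_graph R L,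
     combinatorial_embedding f & induces phi f) /\
  (stable R phi ->
   exists2 f : ext_graph R G -> ext_graph R L,
     combinatorial_embedding f & induces phi f).
Proof.
split=> [ws flats|st].
  have [f f_ind] := weakly_stable_induces hphi ws; exists f => //.
  by split; [exact: (induces_injective hphi f_ind) | exact: (adj_of_flats hphi f_ind flats)].
have ws : weakly_stable R phi.
  by move: st => [D st] l /st[l' l's ll']; exists l' => //; exists D.
have [f f_ind] := weakly_stable_induces hphi ws; exists f => //.
by split; [exact: (induces_injective hphi f_ind) | exact: (adj_of_stable hphi f_ind st)].
Qed.
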